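(* Let $M>0$, let $k\ge 2$ be an integer, and let $N_0\subset\mathbb{R}^2$ be a regular polygon with $k$ vertices, centered at $0$, whose vertices have distance $\rho\in(0,1)$ from $0$ (for $k=2$, $N_0$ is a line segment with midpoint $0$ and length $2\rho$). Let $B\subset\mathbb{R}^3$ be the convex hull of $(\Omega\times\{0\})\cup(N_0\times\{-M\})$ and let $u\colon\Omega\to[-M,0]$, $u(x,y)=\min\{z:(x,y,z)\in B\}$, be the function describing its lower boundary. Then $u$ is not a minimizer of $J$ over $C_M$.
   Context: Let $\Omega=\{(x,y)\in\mathbb{R}^2: x^2+y^2\le 1\}$. For $M>0$, $C_M$ denotes the set of all functions $u\colon\Omega\to[-M,0]$ that are convex and closed (i.e. lower semicontinuous). Each such $u$ is locally Lipschitz in $\operatorname{int}\Omega$, hence differentiable a.e., and \[ J(u)=\int_\Omega\frac{1}{|\nabla u|^2+1}\,dx\,dy . \] *)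

(* Defs.v *)
From HB Require Import structures.
From mathcomp Require Import all_boot all_order all_algebra.
From mathcomp Require Import all_classical all_reals all_analysis.

Set Implicit Arguments.
Unset Strict Implicit.
Unset Printing Implicit Defensive.

Import Order.TTheory GRing.Theory Num.Theory.
Import numFieldNormedType.Exports.

Local Open Scope classical_set_scope.
Local Open Scope ring_scope.

(* The regular algebra R^o makes the products normed modules over R. The
   library norm on a product is the sup norm, so Euclidean lengths are
   written out in coordinates below. *)
Notation plane R := (R^o * R^o)%type.
Notation space R := (R^o * R^o * R^o)%type.

Definition Omega (R : realType) : set (plane R) :=
  [set p | p.1 ^+ 2 + p.2 ^+ 2 <= 1].

Definition convex_hull (R : realType) (E : lmodType R) (A : set E) : set E :=
  smallest (@convex_set R E) A.

Definition is_min (R : realType) (A : set R) (m : R) : Prop :=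
  A m /\ lbound A m.

(* Functions on Omega are represented by total functions on the plane whose
   values outside Omega are irrelevant. In the subspace topology the points
   outside Omega are isolated, so the last clause is lower semicontinuity of
   the restriction of u to Omega. *)
Definition C_ (R : realType) (M : R) (u : plane R -> R) : Prop :=
  [/\ forall p, Omega p -> - M <= u p <= 0,
      convex_function (@Omega R) u &
      lower_semicontinuous (EFin \o u : subspace (@Omega R) -> \bar R)].

Definition grad_norm2 (R : realType) (u : plane R -> R) (p : plane R) : R :=
  ('D_((1, 0) : plane R) (u : plane R -> R^o) p) ^+ 2 +
  ('D_((0, 1) : plane R) (u : plane R -> R^o) p) ^+ 2.

(* 'D_v is total, with an unspecified value where the limit does not exist.
   For u in C_ M such points, as well as the boundary of Omega (where 'D_v
   depends on the values of u outside Omega), are covered by a Borel null set;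
   since the integrand lies in [0, 1], they do not affect the integral. *)
Definition J (R : realType) (u : plane R -> R) : \bar R :=
  (\int[@lebesgue_measure R \x @lebesgue_measure R]_(p in @Omega R)
     (1 / (grad_norm2 u p + 1))%:E)%E.

Definition is_minimizer (R : realType) (M : R) (u : plane R -> R) : Prop :=
  C_ M u /\ forall v : plane R -> R, C_ M v -> (J u <= J v)%E.

(* The vertices are at distance rho from 0; theta is the angle of the first
   one. For k = 2 this is a segment of length 2 * rho with midpoint 0. *)
Definition regular_polygon (R : realType) (k : nat) (rho theta : R) :
    set (plane R) :=
  convex_hull [set p : plane R | exists2 j : nat, (j < k)%N &
    p = (rho * cos (theta + 2 * pi * j%:R / k%:R),
         rho * sin (theta + 2 * pi * j%:R / k%:R))].

Definition body (R : realType) (M : R) (N0 : set (plane R)) : set (space R) :=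
  convex_hull ((@Omega R `*` [set 0]) `|` (N0 `*` [set - M])).

(* Main.v *)
Require Import Defs.
From HB Require Import structures.
From mathcomp Require Import all_boot all_order all_algebra.
From mathcomp Require Import all_classical all_reals all_analysis.
From mathcomp Require Import measurable_realfun.
From mathcomp Require Import ring lra.

(** Near the direction of the vertex [V = (rho * cos theta, rho * sin theta)]
    the lower boundary of the body is the cone with apex [(V, - M)] over an
    arc of the unit circle, and such a conical part is not optimal. The
    function [1 / (1 + |p| ^ 2)] of the gradient [p] is concave in the
    direction orthogonal to [p], and on the axis of the cone this is the
    direction in which the gradient varies. As a consequence, pulling an
    additional point out of the cone lowers the resistance.

    Use coordinates whose first axis points to [V], so that [V = (rho, 0)].
    For [rho < q < 1] and a small angle [beta], let [b = cos beta],
    [r = M / (1 - rho * b)] and [h = r * (1 - q * b)]. The competitor is the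
    lower boundary of the convex hull of the body and the point [P] over
    [(q, 0)] at depth [h], which lies slightly outside the body. The depth is
    chosen so that [P] lies in the tangent planes of the cone along the rays
    from [V] to the points [N] of the circle at the angles [beta] and
    [- beta]. The hull replaces the sector between these rays by the cone with
    apex [P] over the same arc and by two flat triangles [V P N] of slope [r],
    and leaves everything else unchanged ([competitor_attained] and
    [competitor_below]; the shape of [u] itself is given by [framed_ge] and
    [framed_ray]). In particular it stays in the class [C_ M]
    ([C_competitor]).

    A cone with apex [(a, 0)] at depth [H] over the circle has slope
    [H / (1 - a * cos t)] along the ray to the point of angle [t], and the
    sector over the arc element [dt] has area [(1 - a * cos t) / 2 * dt]
    ([integral_sector]). With [F s = 1 / (s ^ 2 + 1)] and [c = cos t], the
    resistance therefore changes by the integral over [- beta <= t <= beta]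
    of one half of

      [(1 - q * c) * F (h / (1 - q * c)) + (q - rho) * c * F r
         - (1 - rho * c) * F (M / (1 - rho * c))],

    which is negative inside the interval as soon as [beta] is small
    ([density_gain]); [J_competitor_lt] collects this. Outside the sector
    only the equality of both integrands is used, so the resistance is cut
    along the sector by a form of additivity that asks for no measurability
    of the integrand ([ge0_integral_split]). *)

Import Order.TTheory GRing.Theory Num.Theory.
Import numFieldNormedType.Exports.

Local Open Scope classical_set_scope.
Local Open Scope ring_scope.

Set Implicit Arguments.
Unset Strict Implicit.
Unset Printing Implicit Defensive.

(** * Nonnegative integrands that need not be measurable *)

Section lower_integral.
Context d (T : measurableType d) (R : realType) (mu : {measure set T -> \bar R}).
Local Open Scope ereal_scope.
Import HBNNSimple.

Lemma le_ge0_integral (D : set T) (f g : T -> \bar R) :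
  (forall x, D x -> 0 <= f x) -> (forall x, D x -> f x <= g x) ->
  \int[mu]_(x in D) f x <= \int[mu]_(x in D) g x.
Proof.
move=> f0 fg; rewrite !ge0_integralE//; last first.
  by move=> x Dx; exact: le_trans (f0 _ Dx) (fg _ Dx).
apply: ereal_sup_le => _ [h /= hf <-]; exists h => //= x.
apply: (le_trans (hf x)); rewrite /patch; case: ifPn => //.
by rewrite inE => /fg.
Qed.

(** The integral of a nonnegative function is a supremum over the simple
    functions below it, and a simple function can be cut along a measurable
    set; the integrand itself may be arbitrary. The functional [J] needs this
    generality, since its integrand is not under control at every point. *)
Lemma ge0_integral_split (D A : set T) (f : T -> \bar R) :
  measurable A -> (forall x, D x -> 0 <= f x) ->
  \int[mu]_(x in D) f x =
  \int[mu]_(x in D `&` A) f x + \int[mu]_(x in D `\` A) f x.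
Proof.
move=> mA f0.
(* Cutting a simple function along A gives one inequality; adding a simple
   function below f on A to one below f off A gives the other. *)
have f1 x : (D `&` A) x -> 0 <= f x by move=> [/f0].
have f2 x : (D `\` A) x -> 0 <= f x by move=> [/f0].
apply/eqP; rewrite eq_le; apply/andP; split.
- rewrite (ge0_integralE _ f0); apply: ge_ereal_sup => _ [h /= hf <-].
  rewrite -integralT_nnsfun -(setUv A) ge0_integral_setU//=; last 4 first.
  + exact: measurableC.
  + by apply/measurable_EFinP; exact: measurable_funTS.
  + by move=> x _; rewrite lee_fin.
  + by rewrite disj_set2E setICr.
  rewrite leeD//.
  + rewrite integral_mkcond [leRHS]integral_mkcond; apply: le_ge0_integral => x _.
      by rewrite /patch; case: ifP => // _; rewrite lee_fin.
    by move: (hf x); rewrite /patch in_setI; case: (x \in A); rewrite ?andbT ?andbF.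
  + rewrite integral_mkcond [leRHS]integral_mkcond; apply: le_ge0_integral => x _.
      by rewrite /patch; case: ifP => // _; rewrite lee_fin.
    by move: (hf x); rewrite /patch in_setC in_setD; case: (x \in A); rewrite ?andbT ?andbF.
- rewrite (ge0_integralE _ f1) (ge0_integralE _ f2).
  have [->|foo] := eqVneq (\int[mu]_(x in D) f x) +oo; first exact: leey.
  have ffin : \int[mu]_(x in D) f x \is a fin_num.
    by rewrite ge0_fin_numE ?integral_ge0// lt_neqAle foo leey.
  have key (h1 h2 : {nnsfun T >-> R}) :
     (forall x, (h1 x)%:E <= (f \_ (D `&` A)) x) ->
     (forall x, (h2 x)%:E <= (f \_ (D `\` A)) x) ->
     sintegral mu h1 + sintegral mu h2 <= \int[mu]_(x in D) f x.
    move=> hf1 hf2; rewrite -sintegralD (ge0_integralE _ f0).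
    apply: ereal_sup_ubound; exists (add_nnsfun h1 h2) => //= x.
    have := hf1 x; have := hf2 x; rewrite /patch in_setI in_setD.
    have [h10 h20] : (0 <= h1 x)%R /\ (0 <= h2 x)%R by [].
    case: (x \in A) => /=; rewrite ?andbT ?andbF !lee_fin.
      move=> h2x; have -> : h2 x = 0%R by apply/eqP; rewrite eq_le h2x.
      by rewrite addr0.
    move=> + h1x; have -> : h1 x = 0%R by apply/eqP; rewrite eq_le h1x.
    by rewrite add0r.
  have s2 (h1 : {nnsfun T >-> R}) :
     (forall x, (h1 x)%:E <= (f \_ (D `&` A)) x) ->
     sintegral mu h1 \is a fin_num.
    move=> hf1; rewrite ge0_fin_numE ?sintegral_ge0//.
    apply: le_lt_trans (_ : \int[mu]_(x in D) f x < +oo); last first.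
      by rewrite ltey_eq ffin.
    have := key h1 nnsfun0 hf1; rewrite sintegral0 adde0; apply => x.
    by rewrite /patch; case: ifPn => //; rewrite inE => /f2.
  set S2 := ereal_sup [set sintegral mu h | h in [set h : {nnsfun T >-> R} |
     forall x, (h x)%:E <= (f \_ (D `\` A)) x]].
  have S2fin : S2 \is a fin_num.
    rewrite ge0_fin_numE; last first.
      apply: ereal_sup_ubound; exists nnsfun0; last exact: sintegral0.
      by move=> x; rewrite /patch; case: ifPn => //; rewrite inE => /f2.
    apply: le_lt_trans (_ : \int[mu]_(x in D) f x < +oo); last first.
      by rewrite ltey_eq ffin.
    apply: ge_ereal_sup => _ [h hf <-]; rewrite -[leLHS]add0e -(sintegral0 mu).
    apply: (key nnsfun0) => // x.
    by rewrite /patch; case: ifPn => //; rewrite inE => /f1.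
  rewrite -leeBrDr//; apply: ge_ereal_sup => _ [h1 hf1 <-].
  rewrite leeBrDr// -leeBrDl ?s2//; apply: ge_ereal_sup => _ [h2 hf2 <-].
  by rewrite leeBrDl ?s2//; exact: key.
Qed.

End lower_integral.

(** * Affine changes of variables and rotations *)

Section affine_maps.
Context (R : realType).
Local Open Scope ereal_scope.
Local Notation mu := (@lebesgue_measure R).
Local Notation T := (measurableTypeR R).

(** Both sides are measures that agree on half-open intervals. *)
Lemma lebesgue_measure_affine (a b : R) (A : set T) : (0 < a)%R ->
  measurable A ->
  mu A = a%:E * mu ((fun y => a * y + b)%R @^-1` A).
Proof.
move=> a0 mA; pose f : T -> T := fun y => (a * y + b)%R.
have mf : measurable_fun setT f.
  by apply: measurable_funD => //; exact: measurable_funM.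
pose nu : {measure set T -> \bar R} :=
  mscale (NngNum (ltW a0)) (pushforward mu f).
transitivity (nu mf A); last by [].
apply: lebesgue_measure_unique => // _ [[c d]] _ <-.
rewrite /nu/= /mscale/= /pushforward/=.
have -> : f @^-1` `]c, d] = `]((c - b) / a)%R, ((d - b) / a)%R]%classic.
  apply/seteqP; split => y /=; rewrite !in_itv/= /f ltr_pdivrMr// ler_pdivlMr//;
    rewrite ltrBlDr lerBrDr mulrC//.
rewrite !lebesgue_measure_itv/= !lte_fin ltr_pM2r ?invr_gt0// ltrD2r.
case: ifPn => cd; last by rewrite mule0.
rewrite -!EFinB -EFinM; congr (_%:E); field; lra.
Qed.

Lemma ge0_integral_affine (a b : R) (g : T -> \bar R) : (0 < a)%R ->
  measurable_fun setT g -> (forall y, 0 <= g y) ->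
  \int[mu]_y g y = a%:E * \int[mu]_y g (a * y + b)%R.
Proof.
move=> a0 mg g0; pose f : T -> T := fun y => (a * y + b)%R.
have mf : measurable_fun setT f.
  by apply: measurable_funD => //; exact: measurable_funM.
pose nu : {measure set T -> \bar R} :=
  mscale (NngNum (ltW a0)) (pushforward mu f).
transitivity (\int[nu mf]_y g y).
  apply: eq_measure_integral => A mA _; exact: lebesgue_measure_affine.
rewrite ge0_integral_mscale//; congr (_ * _).
by rewrite ge0_integral_pushforward.
Qed.

Lemma ge0_integral_shift (b : R) (g : T -> \bar R) :
  measurable_fun setT g -> (forall y, 0 <= g y) ->
  \int[mu]_y g (y + b)%R = \int[mu]_y g y.
Proof.
move=> mg g0; rewrite [RHS](@ge0_integral_affine 1%R b)// mul1e.
by apply: eq_integral => y _; rewrite mul1r.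
Qed.

Definition preserves_area (phi : T * T -> T * T) :=
  measurable_fun setT phi /\
  forall g : T * T -> \bar R, measurable_fun setT g -> (forall p, 0 <= g p) ->
    \int[mu \x mu]_p g (phi p) = \int[mu \x mu]_p g p.

Lemma preserves_area_comp phi psi :
  preserves_area phi -> preserves_area psi -> preserves_area (phi \o psi).
Proof.
move=> [mphi ephi] [mpsi epsi]; split; first exact: (measurableT_comp mphi mpsi).
move=> g mg g0 /=; have := epsi _ (measurableT_comp mg mphi) (fun p => g0 (phi p)).
by move=> /= ->; exact: ephi.
Qed.

(** By Fubini, a shear acts as a translation on each line of its direction. *)
Lemma preserves_area_shear2 (c : R) :
  preserves_area (fun p => (p.1, p.2 + c * p.1)%R).
Proof.
have mphi : measurable_fun setT (fun p : T * T => (p.1, p.2 + c * p.1)%R : T * T).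
  apply: measurable_fun_pair => //=; apply: measurable_funD => //.
  exact: measurable_funM.
split=> // g mg g0; rewrite !fubini_tonelli1//; last 1 first.
  exact: (measurableT_comp mg mphi).
apply: eq_integral => x _; rewrite /fubini_F/=.
rewrite (@ge0_integral_shift _ (fun y => g (x, y)))//.
exact: measurableT_comp.
Qed.

Lemma preserves_area_shear1 (c : R) :
  preserves_area (fun p => (p.1 + c * p.2, p.2)%R).
Proof.
have mphi : measurable_fun setT (fun p : T * T => (p.1 + c * p.2, p.2)%R : T * T).
  apply: measurable_fun_pair => //=; apply: measurable_funD => //.
  exact: measurable_funM.
split=> // g mg g0; rewrite !fubini_tonelli2//; last 1 first.
  exact: (measurableT_comp mg mphi).
apply: eq_integral => y _; rewrite /fubini_G/=.
rewrite (@ge0_integral_shift _ (fun x => g (x, y)))//.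
exact: measurableT_comp.
Qed.

(** [rot t p] lists the coordinates of [p] in the orthonormal frame obtained by
    turning the standard one through the angle [t]. *)
Definition rot (t : R) (p : T * T) : T * T :=
  (p.1 * cos t + p.2 * sin t, - p.1 * sin t + p.2 * cos t)%R.

Lemma rotD (s t : R) : rot s \o rot t = rot (s + t)%R.
Proof.
apply/funext => -[x y]; rewrite /rot/= cosD sinD; congr (_, _); ring.
Qed.

(** A rotation by [t] is the product of three shears with coefficients
    [tan (t / 2)], [- sin t] and [tan (t / 2)]. *)
Lemma preserves_area_rot_aux (t : R) :
  cos (t / 2) != 0%R -> preserves_area (rot t).
Proof.
move=> c0; pose k := tan (t / 2); pose s := sin t.
suff -> : rot t = (fun p : T * T => (p.1 + k * p.2, p.2)%R) \o
    ((fun p : T * T => (p.1, p.2 + (- s) * p.1)%R) \o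
    (fun p : T * T => (p.1 + k * p.2, p.2)%R)).
  apply: preserves_area_comp; first exact: preserves_area_shear1.
  apply: preserves_area_comp; first exact: preserves_area_shear2.
  exact: preserves_area_shear1.
have tE : (t = t / 2 + t / 2)%R by field.
have cs : (cos (t / 2) ^+ 2 + sin (t / 2) ^+ 2 = 1)%R := cos2Dsin2 _.
have kc : (k * cos (t / 2) = sin (t / 2))%R by rewrite /k /tan divfK.
have es : (s = 2 * sin (t / 2) * cos (t / 2))%R.
  by rewrite /s {1}tE sinD; ring.
have ec' : (cos t = cos (t / 2) ^+ 2 - sin (t / 2) ^+ 2)%R.
  by rewrite {1}tE cosD; ring.
have ec : (cos t = 1 - k * s)%R.
  have -> : (1 = cos (t / 2) ^+ 2 + sin (t / 2) ^+ 2)%R by [].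
  by rewrite es ec' -kc; ring.
have es2 : (s = k * (1 + cos t))%R.
  have -> : (1 + cos t = 2 * cos (t / 2) ^+ 2)%R.
    by rewrite ec' -[X in (X + _)%R]cs; ring.
  by rewrite es -kc; ring.
apply/funext => -[x y]; rewrite /rot/= -/s.
congr (_, _); last by rewrite ec; ring.
have es3 : (s = 2 * k - k ^+ 2 * s)%R by rewrite {1}es2 ec; ring.
transitivity (x * (1 - k * s) + y * (2 * k - k ^+ 2 * s))%R; last by ring.
by rewrite -es3 -ec.
Qed.

(** The decomposition into shears excludes the odd multiples of [pi], and [t]
    and [t / 2] cannot both be of that kind. *)
Lemma preserves_area_rot (t : R) : preserves_area (rot t).
Proof.
have [c0|c0] := eqVneq (cos (t / 2)) 0%R; last exact: preserves_area_rot_aux.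
have -> : t = (t / 2 + t / 2)%R by field.
rewrite -rotD; suff : preserves_area (rot (t / 2)).
  by move=> h; exact: preserves_area_comp.
apply: preserves_area_rot_aux; apply/eqP => c1.
have := c0; have {1}-> : (t / 2 = t / 2 / 2 + t / 2 / 2)%R by field.
have := cos2Dsin2 (t / 2 / 2); rewrite cosD c1 => h1 h2; nra.
Qed.

End affine_maps.

(** * Integration over a sector *)

Section sector_integral.
Context (R : realType).
Local Open Scope ereal_scope.
Local Notation mu := (@lebesgue_measure R).
Local Notation T := (measurableTypeR R).

(** Change of variables [(x, y) = (t + a, t * m)], whose Jacobian is [t]; the
    slope [m] as seen from the point [(a, 0)] becomes the outer variable. *)
Lemma ge0_integral_slope (a : R) (g : T * T -> \bar R) :
  measurable_fun setT g -> (forall p, 0 <= g p) ->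
  (forall x y, (x <= a)%R -> g (x, y) = 0) ->
  \int[mu \x mu]_p g p =
  \int[mu]_m \int[mu]_t (if (0 < t)%R then t%:E * g (t + a, t * m)%R else 0).
Proof.
move=> mg g0 ga.
pose h (p : T * T) := if (0 < p.1)%R then p.1%:E * g (p.1 + a, p.1 * p.2)%R else 0.
have mgt : measurable_fun setT (fun p : T * T => g (p.1 + a, p.1 * p.2)%R).
  apply: (measurableT_comp mg); apply: measurable_fun_pair => /=.
    exact: measurable_funD.
  exact: measurable_funM.
have mh : measurable_fun setT h.
  apply: measurable_fun_ifT => //=.
  - exact: measurable_fun_ltr.
  - apply: emeasurable_funM => //; apply/measurable_EFinP; exact: measurable_fst.
have h0 p : 0 <= h p.
  by rewrite /h; case: ifPn => // p0; rewrite mule_ge0// lee_fin ltW.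
transitivity (\int[mu]_t \int[mu]_m h (t, m)); last first.
  exact: fubini_tonelli.
transitivity (\int[mu]_x (fubini_F mu g) x); first exact: fubini_tonelli1.
transitivity (\int[mu]_t (fubini_F mu g (t + a)%R)).
  apply/esym; apply: (@ge0_integral_shift _ a (fubini_F mu g)).
    exact: measurable_fun_fubini_tonelli_F.
  by move=> x; exact: integral_ge0.
apply: eq_integral => t _; rewrite /fubini_F /h/=.
have [t0|t0] := ltP 0%R t; last first.
  by rewrite integral0 integral0_eq// => y _; rewrite ga// gerDr.
rewrite (@ge0_integral_affine _ t 0%R)//; last exact: measurableT_comp.
rewrite -ge0_integralZl_EFin//; last 2 first.
- apply: (measurableT_comp mg); apply: measurable_fun_pair => //=.
  by apply: measurable_funD => //; exact: measurable_funM.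
- exact: ltW.
by apply: eq_integral => m _; rewrite addr0.
Qed.

Lemma integral_id0 (c : R) : (0 < c)%R ->
  \int[mu]_(t in `]0%R, c[) t%:E = (c ^+ 2 / 2)%:E.
Proof.
move=> c0; rewrite -(integral_itv_bndoo true false); last first.
  by apply/measurable_EFinP; exact: measurable_funTS.
rewrite (@continuous_FTC2 _ _ (fun x => x ^+ 2 / 2)%R)//.
- by rewrite -EFinB; congr (_%:E); ring.
- by apply: continuous_subspaceT => x; exact: cvg_id.
- split.
  + move=> x _; exact: ex_derive.
  + apply: cvg_at_right_filter; apply: cvgM; last exact: cvg_cst.
    exact: exprn_continuous.
  + apply: cvg_at_left_filter; apply: cvgM; last exact: cvg_cst.
    exact: exprn_continuous.
- move=> x _; rewrite derive1E; apply: derive_val.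
  by apply: is_derive_eq; rewrite /GRing.scale/=; field.
Qed.
End sector_integral.

Section sector_angle.
Context (R : realType).
Local Open Scope ereal_scope.
Local Notation mu := (@lebesgue_measure R).
Local Notation T := (measurableTypeR R).

(** The part of the unit disk seen from [(a, 0)] between the points
    [(b, s)] and [(b, - s)] of the circle, where [s] is the square root of
    [1 - b ^+ 2]. *)
Definition open_sector (a b : R) (p : T * T) : bool :=
  ((p.1 ^+ 2 + p.2 ^+ 2 < 1) &&
   ((b - a) * `|p.2| < Num.sqrt (1 - b ^+ 2) * (p.1 - a)))%R.

(** The abscissa, counted from [a], at which the ray of slope [m] issued from
    [(a, 0)] leaves the unit disk. *)
Definition reach (a m : R) : R :=
  ((1 - a ^+ 2) / (a + Num.sqrt (1 + (1 - a ^+ 2) * m ^+ 2)))%R.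

Lemma measurable_inv : measurable_fun [set: R] (fun x : R => x^-1%R).
Proof.
have -> : [set: R] = [set x | x != 0%R] `|` [set 0%R].
  by apply/seteqP; split => x //= _; case: (eqVneq x 0%R) => ?; [right|left].
have o : open [set x : R | x != 0%R].
  exact: open_neq.
apply/measurable_funU => //; first exact: open_measurable.
split; last exact: measurable_fun_set1.
by apply: open_continuous_measurable_fun => // x /[!inE] x0; exact: inv_continuous.
Qed.

Lemma measurable_open_sector (a b : R) : measurable_fun setT (open_sector a b).
Proof.
apply: measurable_and.
  by apply: measurable_fun_ltr => //; apply: measurable_funD => //; exact: measurable_funX.
apply: measurable_fun_ltr.
  by apply: measurable_funM => //; apply: measurableT_comp => //; exact: measurable_snd.
by apply: measurable_funM => //; apply: measurable_funB => //; exact: measurable_fst.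
Qed.

Lemma lt_reach (a m t : R) : (0 < a < 1)%R -> (0 < t)%R ->
  (t < reach a m)%R = ((t + a) ^+ 2 + (t * m) ^+ 2 < 1)%R.
Proof.
move=> /andP[a0 a1] t0; rewrite /reach.
have D0 : (0 < 1 - a ^+ 2)%R by nra.
have m2 : (0 <= m ^+ 2)%R by exact: sqr_ge0.
have Q2 : (0 <= 1 + (1 - a ^+ 2) * m ^+ 2)%R by nra.
have := sqr_sqrtr Q2; have := sqrtr_ge0 (1 + (1 - a ^+ 2) * m ^+ 2).
set Q := Num.sqrt _ => Q0 QE.
have Qa : (a < Q)%R by nra.
rewrite ltr_pdivlMr; last by lra.
(* t (a + Q) = 1 - a^2 is the equation of the positive root of the quadratic
   polynomial (t + a)^2 + (t m)^2 - 1 in t; the other factor is positive. *)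
have E : ((t * (a + Q) - (1 - a ^+ 2)) * (t * Q - t * a + (1 - a ^+ 2)) =
   (1 - a ^+ 2) * ((t + a) ^+ 2 + (t * m) ^+ 2 - 1))%R.
  transitivity (t ^+ 2 * Q ^+ 2 - (t * a - (1 - a ^+ 2)) ^+ 2)%R; first by ring.
  by rewrite QE; ring.
have P : (0 < t * Q - t * a + (1 - a ^+ 2))%R by nra.
by apply/idP/idP => h; rewrite -subr_lt0; [rewrite -(pmulr_rlt0 _ D0) -E pmulr_llt0 ?subr_lt0//
  | rewrite -(pmulr_llt0 _ P) E pmulr_rlt0// subr_lt0].
Qed.

Lemma reach_gt0 (a m : R) : (0 < a < 1)%R -> (0 < reach a m)%R.
Proof.
move=> /andP[a0 a1]; rewrite divr_gt0//; first by nra.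
by rewrite ltr_wpDr// sqrtr_ge0.
Qed.

Lemma integral_sector_slope (a b : R) (Psi : R -> R) :
  (0 < a)%R -> (a < b < 1)%R -> continuous Psi -> (forall m, 0 <= Psi m)%R ->
  \int[mu \x mu]_p (if open_sector a b p then (Psi (p.2 / (p.1 - a)))%:E else 0) =
  \int[mu]_m (if ((b - a) * `|m| < Num.sqrt (1 - b ^+ 2))%R then
     (Psi m * (reach a m ^+ 2 / 2))%:E else 0).
Proof.
move=> a0 /andP[ab b1] cPsi Psi0.
have a01 : (0 < a < 1)%R by rewrite a0 (lt_trans ab).
have mPsi : measurable_fun setT Psi by exact: continuous_measurable_fun.
set g := fun p => if _ then _ else _.
have mg : measurable_fun setT g.
  apply: measurable_fun_ifT => //; first exact: measurable_open_sector.
  apply/measurable_EFinP; apply: (measurableT_comp mPsi).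
  apply: measurable_funM; first exact: measurable_snd.
  apply: (measurableT_comp measurable_inv).
  by apply: measurable_funB => //; exact: measurable_fst.
rewrite (@ge0_integral_slope _ a)//; last 2 first.
- by move=> p; rewrite /g; case: ifP => // _; rewrite lee_fin.
- move=> x y xa; rewrite /g /open_sector/= ifF//; apply/negbTE.
  rewrite negb_and; apply/orP; right; rewrite -leNgt.
  apply: (@le_trans _ _ 0%R); last by rewrite mulr_ge0// subr_ge0 ltW.
  by rewrite mulr_ge0_le0 ?sqrtr_ge0// subr_le0.
apply: eq_integral => m _.
have [hm|hm] := ltP ((b - a) * `|m|)%R (Num.sqrt (1 - b ^+ 2)).
  rewrite EFinM -integral_id0 ?reach_gt0//.
  rewrite -ge0_integralZl_EFin//; last first.
    by move=> t; rewrite /= in_itv/= lee_fin => /andP[/ltW].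
  rewrite [RHS]integral_mkcond; apply: eq_integral => t _.
  rewrite /patch mem_setE in_itv/=; have [t0|t0] := ltP 0%R t => //=.
  rewrite lt_reach// /g /open_sector/= addrK.
  have -> : ((b - a) * `|t * m| < Num.sqrt (1 - b ^+ 2) * t)%R.
    by rewrite normrM (gtr0_norm t0) mulrCA mulrC ltr_pM2r.
  rewrite andbT; case: ifPn => _; last by rewrite mule0.
  by rewrite muleC mulrAC divff ?mul1r// gt_eqF.
apply: integral0_eq => t _; case: ifPn => // t0.
rewrite /g /open_sector/= ifF ?mule0// addrK.
apply/negbTE; rewrite negb_and; apply/orP; right; rewrite -leNgt.
by rewrite normrM (gtr0_norm t0) mulrCA [X in (_ <= X)%R]mulrC ler_pM2r.
Qed.
End sector_angle.

Section sector_substitution.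
Context (R : realType).
Local Notation mu := (@lebesgue_measure R).
Local Notation T := (measurableTypeR R).

(** The slope of the ray from [(a, 0)] to [(cos t, sin t)]. *)
Definition slope (a t : R) : R := sin t / (cos t - a).

Lemma is_derive_slope (a t : R) : a < cos t ->
  is_derive t 1 (slope a) ((1 - a * cos t) / (cos t - a) ^+ 2).
Proof.
move=> act; have d0 : cos t - a != 0 by rewrite subr_eq0 gt_eqF.
have dV : is_derive t 1 (fun x : R => (cos x - a)^-1)
    (- (cos t - a) ^- 2 *: (- sin t - 0)) by exact: is_deriveV.
apply: (is_derive_eq (is_deriveM (f := sin) _ dV)).
rewrite /GRing.scale/= subr0.
have := cos2Dsin2 t => cs.
have -> : 1 - a * cos t = cos t ^+ 2 + sin t ^+ 2 - a * cos t by rewrite cs.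
by field.
Qed.

Lemma le_cos_itv (b x : R) : 0 <= b <= pi -> - b <= x <= b -> cos b <= cos x.
Proof.
move=> /andP[b0 bpi] xb; have {}xb : `|x| <= b by rewrite ler_norml.
rewrite -(cos_norm x) leNgt; apply/negP; rewrite ltr_cos ?in_itv/= ?normr_ge0 ?b0//.
  by rewrite ltNge xb.
exact: le_trans bpi.
Qed.

Lemma lt_cos_itv (b x : R) : 0 <= b <= pi -> - b < x < b -> cos b < cos x.
Proof.
move=> /andP[b0 bpi] xb; have {}xb : `|x| < b by rewrite ltr_norml.
rewrite -(cos_norm x) ltr_cos ?in_itv/= ?normr_ge0 ?b0//.
exact: le_trans (ltW xb) bpi.
Qed.

Lemma reach_slope (a t : R) : 0 < a < 1 -> a < cos t ->
  reach a (slope a t) = cos t - a.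
Proof.
move=> /andP[a0 a1] act; rewrite /reach /slope.
have d0 : 0 < cos t - a by rewrite subr_gt0.
have c1 : cos t <= 1 by exact: cos_le1.
have cs := cos2Dsin2 t.
have -> : 1 + (1 - a ^+ 2) * (sin t / (cos t - a)) ^+ 2 =
    ((1 - a * cos t) / (cos t - a)) ^+ 2.
  have -> : (sin t / (cos t - a)) ^+ 2 = (1 - cos t ^+ 2) / (cos t - a) ^+ 2.
    by rewrite -cs addrAC subrr add0r expr_div_n.
  by field; rewrite gt_eqF.
rewrite sqrtr_sqr ger0_norm; last by rewrite divr_ge0// ?ltW//; nra.
have h1 : 0 < 1 - a ^+ 2 by nra.
have -> : a + (1 - a * cos t) / (cos t - a) = (1 - a ^+ 2) / (cos t - a).
  by field; rewrite gt_eqF.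
by field; rewrite !gt_eqF.
Qed.

Lemma continuous_reach (a : R) : 0 < a < 1 -> continuous (reach a).
Proof.
move=> /andP[a0 a1] m; apply: cvgM; first exact: cvg_cst.
apply: cvgV; first by rewrite gt_eqF// ltr_wpDr// sqrtr_ge0.
apply: cvgD; first exact: cvg_cst.
apply: (@cvg_comp _ _ _ _ (@Num.sqrt R)); last exact: sqrt_continuous.
apply: cvgD; first exact: cvg_cst.
apply: cvgM; first exact: cvg_cst.
exact: exprn_continuous.
Qed.

(** The sector with apex [(a, 0)] over the arc element [dt] at the angle [t] is
    a triangle of area [(1 - a * cos t) / 2 * dt]: its base [dt] lies on the
    tangent of the circle, at distance [1 - a * cos t] from the apex. *)
Lemma integral_sector (a beta : R) (Psi : R -> R) :
  0 < a -> 0 < beta < pi -> a < cos beta ->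
  continuous Psi -> (forall m, 0 <= Psi m) ->
  (\int[mu \x mu]_p (if open_sector a (cos beta) p then
     (Psi (p.2 / (p.1 - a)))%:E else 0) =
  \int[mu]_(t in `[(- beta)%R, beta])
    (Psi (slope a t) * ((1 - a * cos t) / 2))%:E)%E.
Proof.
move=> a0 /andP[b0 bpi] acb cPsi Psi0.
have b1 : cos beta < 1.
  by rewrite -(@cos0 R) ltr_cos// in_itv/= ?lexx ?pi_ge0//; rewrite !ltW.
have a1 : a < 1 by exact: lt_trans b1.
have a01 : 0 < a < 1 by rewrite a0.
have s0 : 0 < sin beta by rewrite sin_gt0_pi// b0.
have sE : Num.sqrt (1 - cos beta ^+ 2) = sin beta.
  by rewrite -(cos2Dsin2 beta) addrAC subrr add0r sqrtr_sqr gtr0_norm.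
have ab0 : 0 < cos beta - a by rewrite subr_gt0.
have acos t : t \in `[- beta, beta] -> a < cos t.
  rewrite in_itv/= => tb; apply: lt_le_trans acb _.
  by apply: le_cos_itv => //; rewrite !ltW.
rewrite integral_sector_slope//; last by rewrite acb.
have NE : slope a (- beta) = - slope a beta by rewrite /slope sinN cosN mulNr.
pose G m := Psi m * (reach a m ^+ 2 / 2).
have cG : continuous G.
  move=> m; apply: cvgM; first exact: cPsi.
  apply: cvgM; last exact: cvg_cst.
  apply: (@cvg_comp _ _ _ _ (fun x : R => x ^+ 2)); last exact: exprn_continuous.
  exact: continuous_reach.
transitivity (\int[mu]_(m in `[slope a (- beta)%R, slope a beta]) (G m)%:E)%E.
  rewrite [RHS]integral_itv_bndoo; last first.
    by apply/measurable_EFinP/measurable_funTS; exact: continuous_measurable_fun.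
  rewrite [RHS]integral_mkcond; apply: eq_integral => m _.
  rewrite /patch mem_setE in_itv/= NE -ltr_norml sE mulrC.
  by rewrite -ltr_pdivlMr.
have dsl t : t \in `[- beta, beta] ->
    derive1 (slope a) t = (1 - a * cos t) / (cos t - a) ^+ 2.
  move=> /acos h; rewrite derive1E; apply: derive_val.
  exact: is_derive_slope.
(* The slope is smooth on a neighbourhood of the closed interval, because
   cos t > a still holds at its end points. *)
have cd t : a < cos t -> {for t, continuous (derive1 (slope a))}.
  move=> act.
  have dE x : a < cos x -> (1 - a * cos x) / (cos x - a) ^+ 2 = derive1 (slope a) x.
    by move=> ax; rewrite derive1E; apply/esym/derive_val; exact: is_derive_slope.
  have nt : {near t, (fun x => (1 - a * cos x) / (cos x - a) ^+ 2) =1 derive1 (slope a)}.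
    have : \forall x \near t, a < cos x by exact: (cvgr_gt _ (continuous_cos (x := t))).
    by apply: filterS => x /dE.
  apply: cvg_trans (near_eq_cvg nt) _; rewrite -dE//.
  have cc : cos x @[x --> t] --> cos t by exact: continuous_cos.
  apply: cvgM; first by apply: cvgB; [exact: cvg_cst|apply: cvgM => //; exact: cvg_cst].
  apply: cvgV; first by rewrite sqrf_eq0 subr_eq0 gt_eqF.
  apply: (@cvg_comp _ _ _ (fun x => cos x - a) (fun x : R => x ^+ 2)); last exact: exprn_continuous.
  by apply: cvgB => //; exact: cvg_cst.
have bb : - beta <= beta by lra.
have mb : - beta \in `[- beta, beta] by rewrite in_itv/= lexx.
have pb : beta \in `[- beta, beta] by rewrite in_itv/= lexx andbT.
have cs t : t \in `[- beta, beta] -> {for t, continuous (slope a)}.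
  move=> /acos ta; apply: differentiable_continuous; apply/derivable1_diffP.
  by have [] := is_derive_slope ta.
rewrite (@integration_by_substitution_increasing _ (slope a))//; last 6 first.
- apply: gtr0_derive1_lt_cc.
  + by move=> x /subset_itv_oo_cc/acos/is_derive_slope[].
  + move=> x /subset_itv_oo_cc xb; rewrite dsl//; have := acos _ xb => ax.
    rewrite divr_gt0// ?exprn_gt0 ?subr_gt0//.
    by have := cos_le1 x; nra.
  + apply: derivable_oo_LRcontinuous_within; split.
    * by move=> x /subset_itv_oo_cc/acos/is_derive_slope[].
    * by apply: cvg_at_right_filter; exact: cs.
    * by apply: cvg_at_left_filter; exact: cs.
- by move=> x xb; apply: cd; apply: acos; apply: subset_itv_oo_cc.
- apply/cvg_ex; exists (derive1 (slope a) (- beta)).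
  by apply: cvg_at_right_filter; exact/cd/acos.
- apply/cvg_ex; exists (derive1 (slope a) beta).
  by apply: cvg_at_left_filter; exact/cd/acos.
- split.
  + by move=> x /subset_itv_oo_cc/acos/is_derive_slope[].
  + by apply: cvg_at_right_filter; exact: cs.
  + by apply: cvg_at_left_filter; exact: cs.
- exact: continuous_subspaceT.
apply: eq_integral => t; rewrite inE => tb /=.
have ta := acos _ tb.
rewrite mulrfctE/= dsl// /G reach_slope// -mulrA; congr (_ * _)%:E.
by field; rewrite subr_eq0 gt_eqF.
Qed.

End sector_substitution.

(** * Rays from a point of the disk *)

Section frame_geometry.
Context (R : realType).
Implicit Types a b c d t x y : R.

(** The gauge of the unit disk with respect to the point [(a, 0)]: it is [0] at
    that point, [1] on the unit circle and linear along the rays from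
    [(a, 0)]. The circle being a conic, the gauge is explicit. The cone with
    apex [(a, 0)] at depth [H] over the circle is the graph of
    [H * (gauge a x y - 1)]. *)
Definition gauge a x y : R :=
  (a * (x - a) + Num.sqrt ((x - a) ^+ 2 + (1 - a ^+ 2) * y ^+ 2)) / (1 - a ^+ 2).

Lemma gauge_ray a t c d : 0 < a < 1 -> 0 <= t -> c ^+ 2 + d ^+ 2 = 1 ->
  gauge a (a + t * (c - a)) (t * d) = t.
Proof.
move=> /andP[a0 a1] t0 cd; rewrite /gauge.
have c1 : c <= 1 by nra.
have D0 : 0 < 1 - a ^+ 2 by nra.
have -> : (a + t * (c - a) - a) ^+ 2 + (1 - a ^+ 2) * (t * d) ^+ 2 =
    (t * (1 - a * c)) ^+ 2.
  have -> : (t * d) ^+ 2 = t ^+ 2 * (1 - c ^+ 2) by rewrite -cd; ring.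
  by ring.
rewrite sqrtr_sqr ger0_norm; last by rewrite mulr_ge0//; nra.
by field; rewrite gt_eqF.
Qed.

(** The difference of the squared norm and [1] has the factor [t - 1], with a
    positive cofactor. *)
Lemma disk_ray a t c d : 0 < a < 1 -> c ^+ 2 + d ^+ 2 = 1 -> 0 <= t ->
  ((a + t * (c - a)) ^+ 2 + (t * d) ^+ 2 <= 1) = (t <= 1).
Proof.
move=> /andP[a0 a1] cd t0.
have c1 : c <= 1 by nra.
have E : (a + t * (c - a)) ^+ 2 + (t * d) ^+ 2 - 1 =
    (t - 1) * ((1 - 2 * a * c + a ^+ 2) * t + (1 - a ^+ 2)).
  have -> : (t * d) ^+ 2 = t ^+ 2 * (1 - c ^+ 2) by rewrite -cd; ring.
  by ring.
have P : 0 < (1 - 2 * a * c + a ^+ 2) * t + (1 - a ^+ 2).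
  have : 0 <= 1 - 2 * a * c + a ^+ 2 by nra.
  by move=> h; have := mulr_ge0 h t0; nra.
by rewrite -subr_le0 E pmulr_lle0// subr_le0.
Qed.

Definition closed_sector a b x y : bool :=
  (x ^+ 2 + y ^+ 2 <= 1) &&
  ((b - a) * `|y| <= Num.sqrt (1 - b ^+ 2) * (x - a)).

(** Coordinates of a sector: [(c, d)] is the point where the ray from [(a, 0)]
    meets the circle, and [t] is the gauge. *)
Lemma closed_sector_ray a b x y : 0 < a -> a < b < 1 ->
  closed_sector a b x y ->
  exists t c d, [/\ 0 <= t <= 1, b <= c, c ^+ 2 + d ^+ 2 = 1,
    x = a + t * (c - a) & y = t * d].
Proof.
move=> a0 /andP[ab b1] /andP[xy1 sxy].
have s0 : 0 < 1 - b ^+ 2 by nra.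
have := sqr_sqrtr (ltW s0); have := sqrtr_gt0 (1 - b ^+ 2); rewrite s0.
move: sxy; set s := Num.sqrt (1 - b ^+ 2) => sxy s_gt0 sE.
have y0 : 0 <= `|y| by [].
have xa : a <= x by nra.
have D0 : 0 < 1 - a ^+ 2 by nra.
have q0 : 0 <= (x - a) ^+ 2 + (1 - a ^+ 2) * y ^+ 2.
  by rewrite addr_ge0 ?sqr_ge0// mulr_ge0 ?sqr_ge0// ltW.
have QE := sqr_sqrtr q0; have Q0 := sqrtr_ge0 ((x - a) ^+ 2 + (1 - a ^+ 2) * y ^+ 2).
pose t := gauge a x y.
have tE : (1 - a ^+ 2) * t = a * (x - a) + Num.sqrt ((x - a) ^+ 2 + (1 - a ^+ 2) * y ^+ 2).
  by rewrite /t /gauge mulrC divfK// gt_eqF.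
move: QE Q0 tE; set Q := Num.sqrt ((x - a) ^+ 2 + _) => QE Q0 tE.
have t0 : 0 <= t by rewrite -(pmulr_rge0 _ D0) tE addr_ge0// mulr_ge0 ?subr_ge0// ltW.
have quad : (x - a) ^+ 2 + 2 * a * t * (x - a) + a ^+ 2 * t ^+ 2 + y ^+ 2 = t ^+ 2.
  have e : Q = (1 - a ^+ 2) * t - a * (x - a) by rewrite tE; ring.
  have : (1 - a ^+ 2) * ((x - a) ^+ 2 + 2 * a * t * (x - a) + a ^+ 2 * t ^+ 2 + y ^+ 2)
    = (1 - a ^+ 2) * t ^+ 2.
    by move: QE; rewrite e => QE; lra.
  by apply: mulfI; rewrite gt_eqF.
have [t00|tn0] := eqVneq t 0.
  exists 0, 1, 0; split => //; rewrite ?lexx ?ler01 ?(ltW b1)//; first by ring.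
  - by move: quad; rewrite t00; nra.
  - by move: quad; rewrite t00 mul0r; nra.
have tp : 0 < t by rewrite lt_neqAle eq_sym tn0.
pose c := a + (x - a) / t; pose d := y / t.
have xE : x = a + t * (c - a) by rewrite /c; field.
have yE : y = t * d by rewrite /d; field.
have cd : c ^+ 2 + d ^+ 2 = 1.
  have -> : c ^+ 2 + d ^+ 2 =
     ((x - a) ^+ 2 + 2 * a * t * (x - a) + a ^+ 2 * t ^+ 2 + y ^+ 2) / t ^+ 2.
    by rewrite /c /d; field.
  by rewrite quad divff// sqrf_eq0.
clearbody c d.
exists t, c, d; split => //.
  by rewrite t0 -(disk_ray (c := c) (d := d) (a := a))// -?xE -?yE// a0/=; lra.
rewrite leNgt; apply/negP => cb.
have ca : 0 <= c - a by rewrite -(pmulr_rge0 _ tp); lra.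
have h1 : (b - a) * `|d| <= s * (c - a).
  rewrite -(ler_pM2l tp).
  have -> : t * ((b - a) * `|d|) = (b - a) * `|y|.
    by rewrite [in RHS]yE normrM (gtr0_norm tp); ring.
  by have -> : t * (s * (c - a)) = s * (x - a) by rewrite [in RHS]xE; ring.
have d2 : `|d| ^+ 2 = 1 - c ^+ 2 by rewrite real_normK ?num_real// -cd; ring.
have h2 : ((b - a) * `|d|) ^+ 2 <= (s * (c - a)) ^+ 2.
  by rewrite ler_sqr ?nnegrE// mulr_ge0//; lra.
rewrite !exprMn d2 sE in h2.
have h3 : 1 - b ^+ 2 < 1 - c ^+ 2 by nra.
have h4 : (c - a) ^+ 2 < (b - a) ^+ 2 by nra.
have h5 : 0 < (b - a) ^+ 2 by nra.
have : (c - a) ^+ 2 * (1 - b ^+ 2) < (b - a) ^+ 2 * (1 - c ^+ 2).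
  by apply: ltr_pM => //; [exact: sqr_ge0|exact: ltW].
by rewrite mulrC ltNge h2.
Qed.

(** The height grows along each ray, up to that of a point of the arc. *)
Lemma closed_sector_height a b x y : 0 < a -> a < b < 1 ->
  closed_sector a b x y -> `|y| <= Num.sqrt (1 - b ^+ 2).
Proof.
move=> a0 ab sxy; have /andP[ab' b1] := ab.
have b0 : 0 < b by exact: lt_trans ab'.
have [t [c [d [/andP[t0 t1] bc cd _ ->]]]] := closed_sector_ray a0 ab sxy.
rewrite normrM (ger0_norm t0); apply: (@le_trans _ _ `|d|); first by rewrite ler_piMl.
have -> : `|d| = Num.sqrt (1 - c ^+ 2).
  by rewrite -cd addrAC subrr add0r sqrtr_sqr.
rewrite ler_wsqrtr// lerD2l lerN2 ler_sqr ?nnegrE//; first exact: ltW.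
exact: le_trans (ltW b0) bc.
Qed.

End frame_geometry.

(** * The competitor in the frame of the vertex *)

(** In this section [U] is the given function in orthonormal coordinates whose
    first axis points to the vertex [(rho, 0)]. It is bounded below by the
    tangent planes of the cone with apex [(rho, 0)] at depth [M], for all
    contact points [(c, d)] of the circle with [b <= c], and bounded above by
    the segments from the apex to the circle; so it is that cone on the sector
    of opening [b]. The competitor is the convex hull of [U] and of the point
    [(q, 0)] at depth [h]. *)
Section competitor.
Variables (R : realType) (M rho q b : R) (U : R -> R -> R).
Hypothesis M0 : 0 < M.
Hypothesis rho0 : 0 < rho.
Hypothesis rhoq : rho < q.
Hypothesis qb : q < b.
Hypothesis b1 : b < 1.

Local Notation s := (Num.sqrt (1 - b ^+ 2)).
(** The slope of the cone with apex [(rho, 0)] along the two extreme rays of the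
    sector, towards [(b, s)] and [(b, - s)]. *)
Definition side_slope : R := M / (1 - rho * b).
Local Notation r := side_slope.
(** With this depth the new point lies in the tangent planes of the cone along
    both extreme rays. Therefore the convex hull changes [U] only inside
    the sector. *)
Definition apex_depth : R := r * (1 - q * b).
Local Notation h := apex_depth.

(** The hull is a cone with the new apex over the arc, and two flat triangles
    spanned by the old apex, the new apex and an end point of the arc. *)
Definition competitor (x y : R) : R :=
  if closed_sector q b x y then h * (gauge q x y - 1)
  else if closed_sector rho b x y then r * (b * x + s * `|y| - 1)
  else U x y.
Local Notation W := competitor.

Hypothesis U_ge : forall c d x y, c ^+ 2 + d ^+ 2 = 1 -> b <= c ->
  x ^+ 2 + y ^+ 2 <= 1 -> M / (1 - rho * c) * (c * x + d * y - 1) <= U x y.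
Hypothesis U_ray : forall t c d, 0 <= t <= 1 -> c ^+ 2 + d ^+ 2 = 1 ->
  U (rho + t * (c - rho)) (t * d) <= M * (t - 1).
Hypothesis U_le0 : forall x y, x ^+ 2 + y ^+ 2 <= 1 -> U x y <= 0.
Hypothesis U_geM : forall x y, x ^+ 2 + y ^+ 2 <= 1 -> - M <= U x y.
Hypothesis U_convex : forall t x y x' y', 0 <= t <= 1 ->
  x ^+ 2 + y ^+ 2 <= 1 -> x' ^+ 2 + y' ^+ 2 <= 1 ->
  U (t * x + (1 - t) * x') (t * y + (1 - t) * y') <=
  t * U x y + (1 - t) * U x' y'.

Lemma disk_convex (t x y x' y' : R) : 0 <= t <= 1 ->
  x ^+ 2 + y ^+ 2 <= 1 -> x' ^+ 2 + y' ^+ 2 <= 1 ->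
  (t * x + (1 - t) * x') ^+ 2 + (t * y + (1 - t) * y') ^+ 2 <= 1.
Proof.
move=> /andP[t0 t1] p p'.
have E : (t * x + (1 - t) * x') ^+ 2 + (t * y + (1 - t) * y') ^+ 2 =
  t * (x ^+ 2 + y ^+ 2) + (1 - t) * (x' ^+ 2 + y' ^+ 2)
  - t * (1 - t) * ((x - x') ^+ 2 + (y - y') ^+ 2) by ring.
have t2 : 0 <= 1 - t by lra.
have h1 : t * (x ^+ 2 + y ^+ 2) <= t * 1 by rewrite ler_wpM2l.
have h2 : (1 - t) * (x' ^+ 2 + y' ^+ 2) <= (1 - t) * 1 by rewrite ler_wpM2l.
have h3 : 0 <= t * (1 - t) * ((x - x') ^+ 2 + (y - y') ^+ 2).
  by rewrite !mulr_ge0// addr_ge0// sqr_ge0.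
lra.
Qed.

Let q01 : 0 < q < 1. Proof. by apply/andP; split; move: rho0 rhoq qb b1; lra. Qed.
Let rho01 : 0 < rho < 1. Proof. by apply/andP; split; move: rho0 rhoq qb b1; lra. Qed.
Let rb : 0 < 1 - rho * b.
Proof. by rewrite subr_gt0 mulr_ilt1//; move: rho0 rhoq qb b1; lra. Qed.
Let r0 : 0 < r. Proof. exact: divr_gt0. Qed.
Let qb1 : 0 < 1 - q * b.
Proof. by rewrite subr_gt0 mulr_ilt1//; move: rho0 rhoq qb b1; lra. Qed.
Let h0 : 0 < h. Proof. exact: mulr_gt0. Qed.
Let rM : r * (1 - rho * b) = M. Proof. by rewrite /side_slope divfK// gt_eqF. Qed.
Let hM : h <= M.
Proof. by rewrite -rM /apex_depth ler_pM2l// lerD2l lerN2 ler_pM2r// ?ltW//; move: rho0 rhoq qb b1; lra. Qed.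
Let bsq : 0 < 1 - b ^+ 2. Proof. by move: rho0 rhoq qb b1; nra. Qed.
Let s2 : s ^+ 2 = 1 - b ^+ 2. Proof. by rewrite sqr_sqrtr// ltW. Qed.
Let s0 : 0 < s. Proof. by rewrite sqrtr_gt0. Qed.

(** On a triangle, barycentric coordinates [l1, l2, l3] with respect to the old
    apex, the new apex and the end point [(b, d)] of the arc exhibit the point
    as a combination of the new apex and a point of the extreme ray. The sign
    of [d] selects one of the two triangles. *)
Lemma competitor_arm (x y d : R) : b ^+ 2 + d ^+ 2 = 1 -> d != 0 ->
  0 <= d * y -> (b - rho) * (d * y) <= d ^+ 2 * (x - rho) ->
  d ^+ 2 * (x - q) < (b - q) * (d * y) ->
  exists l x' y', [/\ 0 <= l <= 1, x' ^+ 2 + y' ^+ 2 <= 1,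
    x = (1 - l) * x' + l * q, y = (1 - l) * y' &
    (1 - l) * U x' y' - l * h <= r * (b * x + d * y - 1)].
Proof.
move=> bd dn0 dy sr sq.
have d2 : 0 < d ^+ 2 by rewrite exprn_even_gt0.
have qr : 0 < q - rho by rewrite subr_gt0.
have qrn : q - rho != 0 by rewrite gt_eqF.
pose l1 := ((b - q) * (d * y) - d ^+ 2 * (x - q)) / (d ^+ 2 * (q - rho)).
pose l2 := (d ^+ 2 * (x - rho) - (b - rho) * (d * y)) / (d ^+ 2 * (q - rho)).
pose l3 := d * y / d ^+ 2.
have l1p : 0 < l1 by rewrite divr_gt0 ?subr_gt0// mulr_gt0.
have l2p : 0 <= l2 by rewrite divr_ge0 ?subr_ge0// mulr_ge0// ltW.
have l3p : 0 <= l3 by rewrite divr_ge0// ltW.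
have lE : l1 + l2 + l3 = 1.
  by rewrite /l1 /l2 /l3; field; rewrite ?qrn ?dn0.
have xE : x = l1 * rho + l2 * q + l3 * b.
  by rewrite /l1 /l2 /l3; field; rewrite ?qrn ?dn0.
have yE : y = l3 * d by rewrite /l3; field.
clearbody l1 l2 l3.
have lp : 0 < l1 + l3 by lra.
pose t := l3 / (l1 + l3).
have tE : (l1 + l3) * t = l3 by rewrite /t mulrC divfK// gt_eqF.
have t0 : 0 <= t by rewrite /t divr_ge0// ltW.
have t1 : t <= 1 by rewrite /t ler_pdivrMr//; lra.
clearbody t.
have e1 : 1 - l2 = l1 + l3 by rewrite -lE; ring.
exists l2, (rho + t * (b - rho)), (t * d); split.
- by rewrite l2p/=; lra.
- by rewrite disk_ray.
- rewrite e1 xE mulrDr mulrA tE; have -> : l1 = (l1 + l3) - l3 by ring.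
  by ring.
- by rewrite e1 mulrA tE.
- have t01 : 0 <= t <= 1 by rewrite t0.
  have := U_ray t01 bd => Ut.
  have : (l1 + l3) * U (rho + t * (b - rho)) (t * d) <= (l1 + l3) * (M * (t - 1)).
    by rewrite ler_pM2l.
  have -> : (l1 + l3) * (M * (t - 1)) = - l1 * M.
    transitivity (M * ((l1 + l3) * t - (l1 + l3))); first by ring.
    by rewrite tE; ring.
  rewrite e1 => Ul; apply: le_trans (_ : - l1 * M - l2 * h <= _); first lra.
  rewrite -rM /apex_depth xE yE.
  have -> : b * (l1 * rho + l2 * q + l3 * b) + d * (l3 * d) - 1 =
     l1 * (rho * b - 1) + l2 * (q * b - 1).
    transitivity (l1 * (rho * b) + l2 * (q * b) + l3 * (b ^+ 2 + d ^+ 2) - 1).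
      by ring.
    by rewrite bd mulr1 -[X in _ - X]lE; ring.
  by rewrite le_eqVlt; apply/orP; left; apply/eqP; ring.
Qed.

(** A segment from the new apex to a point outside the sector crosses an
    extreme ray. There [U] agrees with the tangent plane, which passes through
    the new apex and lies below [U]. Convexity of [U] beyond the crossing
    point then shows that the new point does not lower [U] outside the
    sector. *)
Lemma competitor_exit (x y d : R) : b ^+ 2 + d ^+ 2 = 1 -> d != 0 ->
  0 <= d * y -> x ^+ 2 + y ^+ 2 <= 1 ->
  d ^+ 2 * (x - rho) < (b - rho) * (d * y) ->
  forall l x' y', 0 <= l <= 1 -> x' ^+ 2 + y' ^+ 2 <= 1 ->
    x = (1 - l) * x' + l * q -> y = (1 - l) * y' ->
    U x y <= (1 - l) * U x' y' - l * h.
Proof.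
move=> bd dn0 dy xy1 sx l x' y' /andP[l0 l1] xy1' xE yE.
have d2 : 0 < d ^+ 2 by rewrite exprn_even_gt0.
have qr : 0 < q - rho by rewrite subr_gt0.
pose wq := d ^+ 2 * (q - rho).
pose wp := d ^+ 2 * (x - rho) - (b - rho) * (d * y).
have wq0 : 0 < wq by rewrite mulr_gt0.
have wp0 : wp < 0 by rewrite subr_lt0.
(* (1 - k) (q, 0) + k (x, y) is the crossing point, and t its gauge. *)
pose k := wq / (wq - wp).
have kE : k * (wq - wp) = wq by rewrite /k divfK// gt_eqF// subr_gt0 (lt_trans wp0).
have k0 : 0 < k by rewrite divr_gt0// subr_gt0 (lt_trans wp0).
have k1 : k < 1 by rewrite ltr_pdivrMr ?mul1r ?subr_gt0 ?(lt_trans wp0)//; lra.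
have kw : (1 - k) * wq + k * wp = 0 by move: kE; lra.
pose t := k * y / d.
have td : t * d = k * y by rewrite /t divfK.
have t0 : 0 <= t.
  rewrite -(pmulr_lge0 _ d2) expr2 mulrA td mulrAC -mulrA.
  by rewrite mulr_ge0// ltW.
have tx : rho + t * (b - rho) = k * x + (1 - k) * q.
  have : d ^+ 2 * (rho + t * (b - rho)) = d ^+ 2 * (k * x + (1 - k) * q).
    have -> : d ^+ 2 * (rho + t * (b - rho)) = d ^+ 2 * rho + d * (t * d) * (b - rho) by ring.
    by rewrite td; move: kw; rewrite /wq /wp; lra.
  by apply: mulfI; rewrite gt_eqF.
have q2 : q ^+ 2 + 0 ^+ 2 <= 1 by move: q01 => /andP[? ?]; nra.
have t1 : t <= 1.
  rewrite -(disk_ray (c := b) (d := d) rho01)// tx td.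
  have := disk_convex (t := k) _ xy1 q2; rewrite mulr0 addr0; apply.
  by rewrite !ltW.
have t01 : 0 <= t <= 1 by rewrite t0.
pose u' := U (k * x + (1 - k) * q) (k * y).
have Uz : u' <= M * (t - 1) by have := U_ray t01 bd; rewrite tx td.
pose L z w := r * (b * z + d * w - 1).
have Lz : M * (t - 1) = (1 - k) * - h + k * L x y.
  have -> : k * L x y = r * (b * (k * x) + d * (k * y) - k) by rewrite /L; ring.
  have -> : k * x = rho + t * (b - rho) - (1 - k) * q by rewrite tx; ring.
  rewrite -td -rM /apex_depth.
  have -> : d * (t * d) = t * (1 - b ^+ 2) by rewrite -bd; ring.
  by ring.
have Lp : L x y = (1 - l) * L x' y' - l * h.
  by rewrite /L /h xE yE; ring.
have LU : L x' y' <= U x' y' by exact: U_ge.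
pose D := 1 - k + l * k.
have lk : 0 <= l * k by rewrite mulr_ge0// ltW.
have D0 : 0 < D by rewrite /D; lra.
(* The point (x, y) lies between the crossing point and (x', y'). *)
have DE : D = 1 - k + l * k by [].
pose m := (1 - l) * (1 - k) / D.
have mE : D * m = (1 - l) * (1 - k) by rewrite /m mulrC divfK// gt_eqF.
have mE' : D * (1 - m) = l by rewrite mulrBr mE /D; ring.
have m01 : 0 <= m <= 1.
  rewrite -(pmulr_rge0 _ D0) mE mulr_ge0 ?subr_ge0//; last exact: ltW.
  by rewrite -subr_ge0 -(pmulr_rge0 _ D0) mE'.
clearbody D m.
have z1 : (k * x + (1 - k) * q) ^+ 2 + (k * y) ^+ 2 <= 1.
  by rewrite -tx -td disk_ray.
have Dx : x = m * x' + (1 - m) * (k * x + (1 - k) * q).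
  have : D * x = D * (m * x' + (1 - m) * (k * x + (1 - k) * q)).
    transitivity (D * m * x' + D * (1 - m) * (k * x + (1 - k) * q)); last by ring.
    by rewrite mE mE' DE [in LHS]xE [in RHS]xE; ring.
  by apply: mulfI; rewrite gt_eqF.
have Dy : y = m * y' + (1 - m) * (k * y).
  have : D * y = D * (m * y' + (1 - m) * (k * y)).
    transitivity (D * m * y' + D * (1 - m) * (k * y)); last by ring.
    by rewrite mE mE' DE [in LHS]yE [in RHS]yE; ring.
  by apply: mulfI; rewrite gt_eqF.
have : U x y <= m * U x' y' + (1 - m) * u'.
  by rewrite [in leLHS]Dx [in leLHS]Dy; exact: U_convex.
rewrite -(ler_pM2l D0).
have -> : D * (m * U x' y' + (1 - m) * u') = D * m * U x' y' + D * (1 - m) * u'.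
  by ring.
rewrite mE mE' => UD.
rewrite -(ler_pM2l D0); apply: le_trans UD _.
have e1 : l * u' <= l * ((1 - k) * - h + k * L x y).
  by rewrite ler_wpM2l// -Lz.
have e2 : l * k * (1 - l) * L x' y' <= l * k * (1 - l) * U x' y'.
  by rewrite ler_wpM2l// mulr_ge0// subr_ge0.
move: e1; rewrite Lp DE; lra.
Qed.

(** Reflection in the first axis reduces both triangles to one. *)
Lemma signed_height (y : R) : exists d, [/\ b ^+ 2 + d ^+ 2 = 1, d != 0,
  d * y = s * `|y|, 0 <= d * y & d ^+ 2 = s ^+ 2].
Proof.
have sn0 : s != 0 by rewrite gt_eqF.
have [y0|y0] := leP 0 y.
  by exists s; split => //; rewrite ?s2 ?(ger0_norm y0) ?mulr_ge0 ?(ltW s0)//; ring.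
exists (- s); split; rewrite ?oppr_eq0 ?sqrrN ?s2//; first by ring.
- by rewrite (ltr0_norm y0); ring.
- by rewrite mulNr -mulrN mulr_ge0 ?(ltW s0)// oppr_ge0 ltW.
Qed.

Lemma dot_le1 (c d x y : R) : c ^+ 2 + d ^+ 2 = 1 -> x ^+ 2 + y ^+ 2 <= 1 ->
  c * x + d * y <= 1.
Proof. by move=> h1 h2; have := sqr_ge0 (c - x); have := sqr_ge0 (d - y); nra. Qed.

(** Together with [competitor_below] this identifies the competitor with the
    convex hull of [U] and the new point. *)
Lemma competitor_attained (x y : R) : x ^+ 2 + y ^+ 2 <= 1 ->
  exists l x' y', [/\ 0 <= l <= 1, x' ^+ 2 + y' ^+ 2 <= 1,
    x = (1 - l) * x' + l * q, y = (1 - l) * y' &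
    (1 - l) * U x' y' - l * h <= W x y].
Proof.
move=> xy1; rewrite /competitor.
case: ifPn => [|].
  have qb1' : q < b < 1 by rewrite qb b1.
  have [q0 _] := andP q01.
  move=> /(closed_sector_ray q0 qb1') [t [c [d [/andP[t0 t1] bc cd -> ->]]]].
  rewrite gauge_ray//; exists (1 - t), c, d; split; rewrite ?cd//; try by ring.
    by rewrite subr_ge0 t1 lerBlDr lerDl.
  have : U c d <= 0 by apply: U_le0; rewrite cd.
  by move=> /(ler_wpM2l t0); rewrite mulr0; lra.
rewrite {1}/closed_sector xy1/= -ltNge => sq; case: ifPn => [|_]; last first.
  by exists 0, x, y; split => //; rewrite ?lexx ?ler01//; lra.
rewrite /closed_sector xy1/= => sr.
have [d [bd dn0 dyE dy0 d2E]] := signed_height y.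
rewrite -dyE; apply: competitor_arm => //; rewrite d2E dyE.
  by rewrite mulrCA expr2 -mulrA ler_pM2l.
by rewrite [ltRHS]mulrCA expr2 -mulrA ltr_pM2l.
Qed.

(** On the new cone this follows from its tangent planes: they pass through the
    new apex, and they are steeper than those of the old cone, hence lie below
    [U] on the disk. On the triangles the tangent planes along the extreme
    rays serve in the same way, and [competitor_exit] settles the rest. *)
Lemma competitor_below (l x' y' : R) : 0 <= l <= 1 -> x' ^+ 2 + y' ^+ 2 <= 1 ->
  W ((1 - l) * x' + l * q) ((1 - l) * y') <= (1 - l) * U x' y' - l * h.
Proof.
move=> l01 xy1'; have /andP[l0 l1] := l01.
pose x := (1 - l) * x' + l * q; pose y := (1 - l) * y'.
have xE : x = (1 - l) * x' + l * q by []. have yE : y = (1 - l) * y' by [].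
rewrite -xE -yE; clearbody x y.
have [q0 q1] := andP q01.
have l1' : 0 <= 1 - l by rewrite subr_ge0.
have xy1 : x ^+ 2 + y ^+ 2 <= 1.
  have := @disk_convex (1 - l) x' y' q 0 _ xy1'.
  have -> : 1 - (1 - l) = l by ring.
  rewrite mulr0 addr0 -xE -yE; apply.
    by rewrite l1' gerBl.
  by rewrite expr0n addr0 expr_le1// ltW.
rewrite /competitor; case: ifPn => [|].
  have qb1' : q < b < 1 by rewrite qb b1.
  move=> /(closed_sector_ray q0 qb1') [t [c [d [t01 bc cd tx ty]]]].
  have [t0 t1] := andP t01.
  rewrite [in leLHS]tx [in leLHS]ty gauge_ray//.
  have c1 : c <= 1 by nra.
  have qc : 0 < 1 - q * c by nra.
  have rc : 0 < 1 - rho * c by have [? ?] := andP rho01; nra.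
  have e1 : h * (t - 1) = h / (1 - q * c) * (c * x + d * y - 1).
    have -> : c * x + d * y - 1 = (1 - q * c) * (t - 1).
      rewrite tx ty; have -> : d * (t * d) = t * (1 - c ^+ 2) by rewrite -cd; ring.
      by ring.
    by rewrite mulrA divfK// gt_eqF.
  have e2 : h / (1 - q * c) * (c * x + d * y - 1) =
      (1 - l) * (h / (1 - q * c) * (c * x' + d * y' - 1)) - l * h.
    by rewrite xE yE; field; rewrite gt_eqF.
  rewrite e1 e2 lerD2r ler_wpM2l//; apply: le_trans (U_ge cd bc xy1').
  apply: ler_wnM2r; first by rewrite subr_le0 dot_le1.
  rewrite ler_pdivrMr// mulrAC ler_pdivlMr// -rM /apex_depth -!mulrA ler_pM2l//.
  have : 0 <= (q - rho) * (c - b) by rewrite mulr_ge0// subr_ge0// ltW.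
  by rewrite ler_pM2l ?invr_gt0 //; lra.
rewrite {1}/closed_sector xy1/= => _; have [d [bd dn0 dyE dy0 d2E]] := signed_height y.
case: ifPn => [_|].
  have e : r * (b * x + s * `|y| - 1) = (1 - l) * (r * (b * x' + d * y' - 1)) - l * h.
    by rewrite -dyE xE yE /apex_depth; ring.
  by rewrite e lerD2r ler_wpM2l//; exact: U_ge.
rewrite /closed_sector xy1/= -ltNge => sr.
apply: (competitor_exit bd dn0 dy0 xy1 _ l01 xy1' xE yE).
by rewrite d2E dyE expr2 -mulrA [ltRHS]mulrCA ltr_pM2l.
Qed.

Lemma competitor_le (x y : R) : x ^+ 2 + y ^+ 2 <= 1 -> W x y <= U x y.
Proof.
move=> xy1; have := @competitor_below 0 x y; rewrite lexx ler01 => /(_ isT xy1).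
by rewrite subr0 !mul1r !mul0r subr0 addr0.
Qed.

Lemma competitor_geM (x y : R) : x ^+ 2 + y ^+ 2 <= 1 -> - M <= W x y.
Proof.
move=> /competitor_attained [l [x' [y' [/andP[l0 l1] xy' _ _]]]].
apply: le_trans; have := U_geM xy'; have := hM => hM' UM.
have h1 : (1 - l) * - M <= (1 - l) * U x' y' by rewrite ler_wpM2l// subr_ge0.
have h2 : l * h <= l * M by rewrite ler_wpM2l.
lra.
Qed.

(** Both points are combinations of the new apex with points of the graph of
    [U]; regrouping the new apex leaves a combination of points of the graph,
    to which convexity of [U] applies. *)
Lemma competitor_convex (t x y x' y' : R) : 0 <= t <= 1 ->
  x ^+ 2 + y ^+ 2 <= 1 -> x' ^+ 2 + y' ^+ 2 <= 1 ->
  W (t * x + (1 - t) * x') (t * y + (1 - t) * y') <=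
  t * W x y + (1 - t) * W x' y'.
Proof.
move=> /andP[t0 t1].
move=> /competitor_attained [l [a [a' [/andP[l0 l1] A xE yE lW]]]].
move=> /competitor_attained [m [z [z' [/andP[m0 m1] Z xE' yE' mW]]]].
have t1' : 0 <= 1 - t by rewrite subr_ge0.
have l1' : 0 <= 1 - l by rewrite subr_ge0.
have m1' : 0 <= 1 - m by rewrite subr_ge0.
pose k := t * l + (1 - t) * m.
have kE : 1 - k = t * (1 - l) + (1 - t) * (1 - m) by rewrite /k; ring.
have k0 : 0 <= k by rewrite addr_ge0// mulr_ge0.
have k1 : 0 <= 1 - k by rewrite kE addr_ge0// mulr_ge0.
(* If 1 - k = 0, the combination is the new apex itself and p is arbitrary. *)
have [p [p01 kp kp']] : exists p, [/\ 0 <= p <= 1,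
   (1 - k) * p = t * (1 - l) & (1 - k) * (1 - p) = (1 - t) * (1 - m)].
  have [k10|k10] := eqVneq (1 - k) 0.
    have h1 : 0 <= t * (1 - l) by exact: mulr_ge0.
    have h2 : 0 <= (1 - t) * (1 - m) by exact: mulr_ge0.
    by exists 0; split; rewrite ?lexx ?ler01// k10 ?mul0r; move: kE; rewrite k10; lra.
  have kp0 : 0 < 1 - k by rewrite lt_neqAle eq_sym k10.
  exists (t * (1 - l) / (1 - k)); split.
  - rewrite divr_ge0 ?mulr_ge0//= ler_pdivrMr// mul1r kE lerDl mulr_ge0//.
  - by rewrite mulrC divfK.
  - by rewrite mulrBr mulr1 [X in _ - X]mulrC divfK// kE; ring.
pose x0 := p * a + (1 - p) * z; pose y0 := p * a' + (1 - p) * z'.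
have XE : t * x + (1 - t) * x' = (1 - k) * x0 + k * q.
  have -> : (1 - k) * x0 = ((1 - k) * p) * a + ((1 - k) * (1 - p)) * z.
    by rewrite /x0; ring.
  by rewrite kp kp' xE xE' /k; ring.
have YE : t * y + (1 - t) * y' = (1 - k) * y0.
  have -> : (1 - k) * y0 = ((1 - k) * p) * a' + ((1 - k) * (1 - p)) * z'.
    by rewrite /y0; ring.
  by rewrite kp kp' yE yE'; ring.
rewrite XE YE.
have k01 : 0 <= k <= 1 by rewrite k0 -subr_ge0.
apply: le_trans (competitor_below k01 (disk_convex p01 A Z)) _.
have := ler_wpM2l k1 (U_convex p01 A Z).
have -> : (1 - k) * (p * U a a' + (1 - p) * U z z') =
   (1 - k) * p * U a a' + (1 - k) * (1 - p) * U z z' by ring.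
rewrite kp kp' => Uk.
have := ler_wpM2l t0 lW; have := ler_wpM2l t1' mW.
have -> : k * h = t * (l * h) + (1 - t) * (m * h) by rewrite /k; ring.
move: Uk; rewrite -/x0 -/y0; lra.
Qed.

(** The new cone touches the tangent plane along the extreme ray, so the pieces
    of the competitor fit together continuously. *)
Lemma competitor_edge (x y : R) :
  (b - q) * `|y| = s * (x - q) ->
  h * (gauge q x y - 1) = r * (b * x + s * `|y| - 1).
Proof.
move=> edge; have sn0 : s != 0 by rewrite gt_eqF.
pose t := `|y| / s.
have ty : `|y| = t * s by rewrite /t divfK.
have tx : x = q + t * (b - q).
  have : s * (x - q) = s * (t * (b - q)) by rewrite -edge ty; ring.
  by move/(mulfI sn0) => e; rewrite -e; ring.
have -> : gauge q x y = gauge q x `|y| by rewrite /gauge real_normK ?num_real.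
have bs : b ^+ 2 + s ^+ 2 = 1 by rewrite s2; ring.
rewrite ty tx gauge_ray//; last by rewrite divr_ge0// ltW.
have -> : s * (t * s) = t * (1 - b ^+ 2).
  by transitivity (t * s ^+ 2); [ring|rewrite s2].
by rewrite /apex_depth; ring.
Qed.

Lemma profile_sector (x y : R) : closed_sector rho b x y ->
  U x y = M * (gauge rho x y - 1).
Proof.
move=> sxy; have := sxy => /andP[xy1 _]; move: sxy.
have rb' : rho < b < 1 by rewrite b1 (lt_trans rhoq).
move=> /(closed_sector_ray rho0 rb') [t [c [d [t01 bc cd tx ty]]]].
have [t0 t1] := andP t01.
have c1 : c <= 1 by nra.
have rc : 0 < 1 - rho * c by have [? ?] := andP rho01; nra.
rewrite {2}tx {2}ty gauge_ray//; apply/eqP; rewrite eq_le.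
rewrite {1}tx {1}ty U_ray//=; apply: le_trans (U_ge cd bc xy1).
have -> : c * x + d * y - 1 = (1 - rho * c) * (t - 1).
  rewrite tx ty; have -> : d * (t * d) = t * (1 - c ^+ 2) by rewrite -cd; ring.
  by ring.
by rewrite mulrA divfK// gt_eqF.
Qed.

End competitor.

(** * The lower boundary of the body near a vertex *)

Section body_bounds.
Context (R : realType).

Lemma convE (E : lmodType R) (l : {i01 R}) (x y : convex_lmodType E) :
  conv l x y = l%:num *: (x : E) + (1 - l%:num) *: (y : E).
Proof. by []. Qed.

Lemma convex_set_hull (E : lmodType R) (A : set E) : convex_set (convex_hull A).
Proof.
move=> x y l; rewrite !inE => hx hy B [cB AB].
have := cB x y l; rewrite !inE; apply; [exact: hx|exact: hy].
Qed.

Lemma subset_hull (E : lmodType R) (A : set E) : A `<=` convex_hull A.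
Proof. by move=> x Ax B [_]; apply. Qed.

Lemma convex_hull_sub (E : lmodType R) (A B : set E) :
  convex_set B -> A `<=` B -> convex_hull A `<=` B.
Proof. by move=> cB AB x; apply. Qed.

Lemma convex_hull_conv (E : lmodType R) (A : set E) (t : R) (x y : E) :
  0 <= t <= 1 -> convex_hull A x -> convex_hull A y ->
  convex_hull A (t *: x + (1 - t) *: y).
Proof.
move=> /andP[t0 t1] Ax Ay.
have := @convex_set_hull E A x y (Itv01 t0 t1); rewrite !inE.
by rewrite convE; apply.
Qed.

Lemma polygon_halfplane (k : nat) (rho theta n1 n2 c : R) :
  (forall j, (j < k)%N ->
    n1 * (rho * cos (theta + 2 * pi * j%:R / k%:R)) +
    n2 * (rho * sin (theta + 2 * pi * j%:R / k%:R)) <= c) ->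
  forall p, regular_polygon k rho theta p -> n1 * p.1 + n2 * p.2 <= c.
Proof.
move=> hj; apply: convex_hull_sub.
  move=> x y l; rewrite !inE convE/= => hx hy.
  have l0 : 0 <= l%:num by [].
  have := ler_wpM2l l0 hx.
  have l1 : 0 <= 1 - l%:num by rewrite subr_ge0 le1.
  by have := ler_wpM2l l1 hy; rewrite /GRing.scale/=; lra.
by move=> _ [j jk ->] /=; exact: hj.
Qed.

Lemma body_halfspace (M : R) (N0 : set (plane R)) (n1 n2 c : R) :
  0 <= c -> n1 ^+ 2 + n2 ^+ 2 = 1 ->
  (forall p, N0 p -> c * (n1 * p.1 + n2 * p.2 - 1) <= - M) ->
  forall p z, body M N0 (p, z) -> c * (n1 * p.1 + n2 * p.2 - 1) <= z.
Proof.
move=> c0 n12 hN p z hb.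
pose B := [set w : (R^o * R^o * R^o)%type | c * (n1 * w.1.1 + n2 * w.1.2 - 1) <= w.2].
suff : B (p, z) by [].
move: (p, z) hb; apply: convex_hull_sub.
  move=> x y l; rewrite !inE convE/B/= => hx hy.
  have l0 : 0 <= l%:num by [].
  have := ler_wpM2l l0 hx.
  have l1 : 0 <= 1 - l%:num by rewrite subr_ge0 le1.
  by have := ler_wpM2l l1 hy; rewrite /GRing.scale/=; lra.
move=> [[x y] z'] [[/= h ->]|[/= h ->]]; rewrite /B/=; last exact: (hN (x, y)).
have : n1 * x + n2 * y <= 1 by exact: dot_le1.
by rewrite -subr_le0 => h'; exact: mulr_ge0_le0.
Qed.

End body_bounds.

Section profile.
Variables (R : realType) (M : R) (k : nat) (rho theta b : R) (u : plane R -> R).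
Hypothesis M0 : 0 < M.
Hypothesis k2 : (2 <= k)%N.
Hypothesis rho0 : 0 < rho.
Hypothesis rho1 : rho < 1.
Hypothesis hu : forall p : plane R, Omega p ->
  is_min [set z : R | body M (regular_polygon k rho theta) (p, z)] (u p).
Hypothesis b01 : 0 < b < 1.
Hypothesis hb : Num.sqrt (1 - b ^+ 2) <= b * sin (pi / k%:R).

(** [u] expressed in the coordinates [rot theta p]. *)
Definition framed (x y : R) : R := u (rot (- theta) (x, y)).

Lemma OmegaE (x y : R) : Omega (rot (- theta) (x, y)) = (x ^+ 2 + y ^+ 2 <= 1) :> Prop.
Proof.
rewrite /Omega/rot/= cosN sinN; congr (is_true (_ <= _)).
have := cos2Dsin2 theta; move: (cos theta) (sin theta) => c s cs.
transitivity ((c ^+ 2 + s ^+ 2) * (x ^+ 2 + y ^+ 2)); first by ring.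
by rewrite cs mul1r.
Qed.

(** Seen from the direction [(c, d)], which is close to the first vertex, no
    other vertex is higher. With [x = pi * j / k] the difference of both sides
    is [2 * sin x * (c * sin x - d * cos x)], and [sin x >= sin (pi / k)]. *)
Lemma vertex_below_tangent (c d : R) (j : nat) : (j < k)%N ->
  c ^+ 2 + d ^+ 2 = 1 -> b <= c ->
  c * cos (2 * pi * j%:R / k%:R) + d * sin (2 * pi * j%:R / k%:R) <= c.
Proof.
move=> jk cd bc.
have [b0 b1] := andP b01.
have k0 : 0 < k%:R :> R by rewrite ltr0n (leq_trans _ k2).
have [->|j0] := eqVneq j 0%N.
  by rewrite mulr0 mul0r cos0 sin0 mulr1 mulr0 addr0.
pose x := pi * j%:R / k%:R : R.
have -> : 2 * pi * j%:R / k%:R = x + x :> R by rewrite /x; field; rewrite gt_eqF.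
have pi0 := pi_gt0 R.
have j1 : 1 <= j%:R :> R by rewrite ler1n lt0n.
have jk1 : j%:R + 1 <= k%:R :> R by rewrite natr1 ler_nat.
have x1 : pi / k%:R <= x.
  by rewrite /x ler_pM2r ?invr_gt0// ler_peMr// ltW.
have x2 : x <= pi - pi / k%:R.
  have -> : pi - pi / k%:R = pi * (k%:R - 1) / k%:R :> R by field; rewrite gt_eqF.
  by rewrite /x ler_pM2r ?invr_gt0// ler_pM2l// lerBrDr.
have kpi : 0 < pi / k%:R :> R by exact: divr_gt0.
have sx : sin (pi / k%:R) <= sin x.
  rewrite -[leLHS]cosBpihalf -[leRHS]cosBpihalf -[leLHS]cosN.
  apply: le_cos_itv; rewrite opprB.
    have : pi / k%:R <= pi / 2 :> R.
      by rewrite ler_pM2l// lef_pV2 ?posrE// ler_nat.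
    by move: kpi; lra.
  by apply/andP; split; lra.
have s0 : 0 < sin (pi / k%:R) :> R.
  by rewrite sin_gt0_pi// kpi/= ltr_pdivrMr// ltr_pMr// ltr1n.
have dle : `|d| <= c * sin x.
  have -> : `|d| = Num.sqrt (1 - c ^+ 2).
    by rewrite -cd addrAC subrr add0r sqrtr_sqr.
  apply: (@le_trans _ _ (Num.sqrt (1 - b ^+ 2))).
    by rewrite ler_wsqrtr// lerD2l lerN2 ler_sqr ?nnegrE//; lra.
  apply: le_trans hb _; apply: ler_pM => //; exact: ltW.
have dc : d * cos x <= `|d|.
  apply: le_trans (ler_norm _) _; rewrite normrM.
  by rewrite ler_piMr// cos_max.
have sx0 : 0 < sin x by exact: lt_le_trans sx.
rewrite cosD sinD.
have -> : c * (cos x * cos x - sin x * sin x) + d * (sin x * cos x + cos x * sin x)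
  = c - 2 * sin x * (c * sin x - d * cos x).
  transitivity (c * (cos x ^+ 2 + sin x ^+ 2) - 2 * sin x * (c * sin x - d * cos x)).
    by ring.
  by rewrite cos2Dsin2 mulr1.
rewrite gerBl mulr_ge0//; first by rewrite mulr_ge0// ltW.
by rewrite subr_ge0; lra.
Qed.

(** The half-space above a tangent plane of the cone contains the disk and the
    bottom face, hence the body. *)
Lemma framed_ge (c d x y : R) : c ^+ 2 + d ^+ 2 = 1 -> b <= c ->
  x ^+ 2 + y ^+ 2 <= 1 ->
  M / (1 - rho * c) * (c * x + d * y - 1) <= framed x y.
Proof.
move=> cd bc; rewrite -OmegaE => /hu [hm _].
have [b0 b1] := andP b01.
have c1 : c <= 1 by nra.
have rc : 0 < 1 - rho * c.
  have : 0 <= rho * (1 - c) by rewrite mulr_ge0 ?subr_ge0// ltW.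
  by move: rho1; lra.
pose n := rot (- theta) (c, d).
have csE := cos2Dsin2 theta.
have nE x' y' : n.1 * (rot (- theta) (x', y')).1 + n.2 * (rot (- theta) (x', y')).2 =
    c * x' + d * y'.
  rewrite /n /rot/= cosN sinN; move: (cos theta) (sin theta) csE => C S CS.
  transitivity ((C ^+ 2 + S ^+ 2) * (c * x' + d * y')); first by ring.
  by rewrite CS mul1r.
have n1 : n.1 ^+ 2 + n.2 ^+ 2 = 1.
  by have := nE c d; rewrite -/n -!expr2 cd.
have := @body_halfspace R M _ n.1 n.2 (M / (1 - rho * c)) _ n1 _ _ _ hm.
rewrite nE /framed; apply; first by rewrite divr_ge0 ?ltW.
move=> p hp.
have : n.1 * p.1 + n.2 * p.2 <= rho * c.
  move: p hp; apply: polygon_halfplane => j jk.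
  have := vertex_below_tangent jk cd bc => h.
  have -> : n.1 * (rho * cos (theta + 2 * pi * j%:R / k%:R)) +
     n.2 * (rho * sin (theta + 2 * pi * j%:R / k%:R)) =
     rho * (c * cos (2 * pi * j%:R / k%:R) + d * sin (2 * pi * j%:R / k%:R)).
    rewrite /n /rot/= cosN sinN cosD sinD.
    set phi := 2 * pi * j%:R / k%:R.
    move: (cos theta) (sin theta) (cos phi) (sin phi) csE => C S C' S' CS.
    transitivity ((C ^+ 2 + S ^+ 2) * (rho * (c * C' + d * S'))); first by ring.
    by rewrite CS mul1r.
  by rewrite ler_pM2l.
move=> h; rewrite mulrAC ler_pdivrMr//.
have -> : - M * (1 - rho * c) = M * (rho * c - 1) by ring.
by rewrite ler_pM2l// lerD2r.
Qed.

(** The body contains the segment from the vertex [(rho, 0)] at depth [M] to a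
    point of the unit circle. *)
Lemma framed_ray (t c d : R) : 0 <= t <= 1 -> c ^+ 2 + d ^+ 2 = 1 ->
  framed (rho + t * (c - rho)) (t * d) <= M * (t - 1).
Proof.
move=> t01 cd; have [t0 t1] := andP t01.
have rho01 : 0 < rho < 1 by rewrite rho0.
have hO : Omega (rot (- theta) (rho + t * (c - rho), t * d)).
  by rewrite OmegaE disk_ray.
have [_] := hu hO; apply.
pose n : plane R := rot (- theta) (c, d).
pose w : plane R := rot (- theta) (rho, 0).
have n1 : body M (regular_polygon k rho theta) (n, 0).
  by apply: subset_hull; left; split => //=; rewrite /n OmegaE cd.
have w1 : body M (regular_polygon k rho theta) (w, - M).
  apply: subset_hull; right; split => //=; apply: subset_hull.
  exists 0%N; first exact: leq_trans k2.
  by rewrite mulr0 mul0r addr0 /w /rot/= cosN sinN; congr (_, _); ring.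
have := convex_hull_conv t01 n1 w1.
rewrite /body /= => H.
have -> : (rot (- theta) (rho + t * (c - rho), t * d), M * (t - 1)) =
   t *: ((n, 0) : (R^o * R^o * R^o)%type) + (1 - t) *: ((w, - M) : (R^o * R^o * R^o)%type).
  rewrite /n /w /rot.
  apply: injective_projections => /=; last by rewrite /GRing.scale/=; ring.
  by apply: injective_projections => /=; rewrite /GRing.scale/=; ring.
exact: H.
Qed.

End profile.

(** * Gradients of cones and planes *)

Section gradients.
Context (R : realType).

(** Directional derivatives are derivatives of functions of one variable; no
    differentiability in the plane is involved. *)
Lemma derive_line (f : plane R -> R^o) (p v : plane R) :
  'D_v f p = 'D_1 (fun h : R => f (h *: v + p) : R^o) 0.
Proof.
have E : (fun h : R => h^-1 *: ((f \o shift p) (h *: v) - f p)) =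
    (fun h : R => h^-1 *: (((fun h0 : R => f (h0 *: v + p)) \o shift 0) (h *: (1 : R^o)) -
      f (0 *: v + p))).
  apply/funext => h /=.
  have -> : h *: (1 : R^o) = h by rewrite /GRing.scale/= mulr1.
  by rewrite addr0 scale0r add0r.
by rewrite /derive E.
Qed.

Lemma is_derive_cone (a H x y al be : R) : 0 < a < 1 -> a < x ->
  is_derive (0 : R) (1 : R)
    (fun h : R => H * (gauge a (x + h * al) (y + h * be) - 1) : R^o)
    (H * ((a * al + ((x - a) * al + (1 - a ^+ 2) * y * be) /
        Num.sqrt ((x - a) ^+ 2 + (1 - a ^+ 2) * y ^+ 2)) / (1 - a ^+ 2))).
Proof.
move=> /andP[a0 a1] ax.
have D0 : 0 < 1 - a ^+ 2 by nra.
pose q h := (x + h * al - a) ^+ 2 + (1 - a ^+ 2) * (y + h * be) ^+ 2 : R.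
have q0 : 0 < q 0.
  rewrite /q !mul0r !addr0; have := sqr_ge0 y => y2.
  rewrite ltr_wpDr//; first by rewrite mulr_ge0// ltW.
  by rewrite exprn_gt0// subr_gt0.
have dq : is_derive (0 : R) (1 : R) (q : R -> R^o)
    (2 * ((x - a) * al + (1 - a ^+ 2) * y * be)).
  by apply: is_derive_eq; rewrite /GRing.scale/= !mul0r !addr0; ring.
have ds : is_derive (0 : R) (1 : R) ((fun h => Num.sqrt (q h)) : R -> R^o)
   ((2 * Num.sqrt (q 0))^-1 * (2 * ((x - a) * al + (1 - a ^+ 2) * y * be))).
  exact: (is_derive1_comp (is_derive1_sqrt q0) dq).
rewrite /gauge.
have sq0 : Num.sqrt (q 0) != 0 by rewrite gt_eqF// sqrtr_gt0.
have qE : q 0 = (x - a) ^+ 2 + (1 - a ^+ 2) * y ^+ 2 by rewrite /q !mul0r !addr0.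
rewrite -qE.
have dg : is_derive (0 : R) (1 : R)
    ((fun h => H * ((a * (x + h * al - a) + Num.sqrt (q h)) * (1 - a ^+ 2)^-1 - 1)) : R -> R^o)
    (H * ((a * al + (2 * Num.sqrt (q 0))^-1 * (2 * ((x - a) * al + (1 - a ^+ 2) * y * be)))
      * (1 - a ^+ 2)^-1)).
  by apply: is_derive_eq; rewrite /GRing.scale/= !mul0r !addr0; ring.
apply: is_derive_eq; rewrite /GRing.scale/=; field.
by rewrite sq0 gt_eqF.
Qed.

(** The slope of the cone [H * (gauge a x y - 1)] along the ray of slope [m]. *)
Definition cone_slope (a H m : R) : R :=
  H * (1 + a / Num.sqrt (1 + (1 - a ^+ 2) * m ^+ 2)) / (1 - a ^+ 2).

Lemma rot_line (t h : R) (v p : plane R) :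
  rot t (h *: v + p) = ((rot t p).1 + h * (rot t v).1, (rot t p).2 + h * (rot t v).2).
Proof.
apply: injective_projections; rewrite /rot/= /GRing.scale/=; ring.
Qed.

Lemma rot_basis (t : R) :
  (((rot t (1, 0)).1 = cos t) * ((rot t (1, 0)).2 = - sin t)) *
  (((rot t (0, 1)).1 = sin t) * ((rot t (0, 1)).2 = cos t)).
Proof. by rewrite /rot/=; do !split; ring. Qed.

(** With [xi = (x - a) / Q], where [Q] is the square root in the gauge, the
    squared norm of the gradient is [(H * (1 + a * xi) / (1 - a ^+ 2)) ^+ 2]. *)
Lemma grad_norm2_cone (u : plane R -> R) (t a H : R) (p : plane R) :
  0 < a < 1 -> a < (rot t p).1 ->
  (\forall z \near p, H * (gauge a (rot t z).1 (rot t z).2 - 1) = u z) ->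
  grad_norm2 u p = cone_slope a H ((rot t p).2 / ((rot t p).1 - a)) ^+ 2.
Proof.
move=> a01 ax uE; have /andP[a0 a1] := a01.
have D0 : 0 < 1 - a ^+ 2 by nra.
have xa : 0 < (rot t p).1 - a by rewrite subr_gt0.
have dE (v : plane R) : 'D_v (u : plane R -> R^o) p =
    H * ((a * (rot t v).1 + (((rot t p).1 - a) * (rot t v).1 + (1 - a ^+ 2) * (rot t p).2 * (rot t v).2) /
        Num.sqrt (((rot t p).1 - a) ^+ 2 + (1 - a ^+ 2) * (rot t p).2 ^+ 2)) / (1 - a ^+ 2)).
  rewrite -(@near_eq_derive _ _ _ (fun z => H * (gauge a (rot t z).1 (rot t z).2 - 1) : R^o) u p v uE).
  rewrite derive_line; under eq_fun do rewrite rot_line/=.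
  apply: derive_val; exact: is_derive_cone.
rewrite /grad_norm2 !dE !rot_basis /cone_slope.
move: (rot t p).1 (rot t p).2 xa {ax dE} => x y xa.
set Q := Num.sqrt ((x - a) ^+ 2 + (1 - a ^+ 2) * y ^+ 2).
have q0 : 0 < (x - a) ^+ 2 + (1 - a ^+ 2) * y ^+ 2.
  by rewrite ltr_wpDr ?exprn_gt0// mulr_ge0 ?sqr_ge0// ltW.
have QE : Q ^+ 2 = (x - a) ^+ 2 + (1 - a ^+ 2) * y ^+ 2.
  by apply: sqr_sqrtr; exact: ltW.
have Q0 : 0 < Q by rewrite sqrtr_gt0.
have -> : Num.sqrt (1 + (1 - a ^+ 2) * (y / (x - a)) ^+ 2) = Q / (x - a).
  have -> : 1 + (1 - a ^+ 2) * (y / (x - a)) ^+ 2 = (Q / (x - a)) ^+ 2.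
    by rewrite [RHS]expr_div_n QE; field; rewrite gt_eqF.
  by rewrite sqrtr_sqr ger0_norm//; apply: divr_ge0; exact: ltW.
have cs := cos2Dsin2 t; move: (cos t) (sin t) cs => C S CS.
transitivity ((C ^+ 2 + S ^+ 2) * (H / (1 - a ^+ 2)) ^+ 2 *
   ((a + (x - a) / Q) ^+ 2 + ((1 - a ^+ 2) * y / Q) ^+ 2)).
  by field; rewrite !gt_eqF.
rewrite CS mul1r.
have -> : ((1 - a ^+ 2) * y / Q) ^+ 2 = (1 - a ^+ 2) * (Q ^+ 2 - (x - a) ^+ 2) / Q ^+ 2.
  have -> : Q ^+ 2 - (x - a) ^+ 2 = (1 - a ^+ 2) * y ^+ 2 by rewrite QE; ring.
  by field; rewrite gt_eqF.
by field; rewrite !gt_eqF.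
Qed.

Lemma grad_norm2_affine (u : plane R -> R) (t r c d : R) (p : plane R) :
  c ^+ 2 + d ^+ 2 = 1 ->
  (\forall z \near p, r * (c * (rot t z).1 + d * (rot t z).2 - 1) = u z) ->
  grad_norm2 u p = r ^+ 2.
Proof.
move=> cd uE.
have dE (v : plane R) : 'D_v (u : plane R -> R^o) p =
    r * (c * (rot t v).1 + d * (rot t v).2).
  rewrite -(@near_eq_derive _ _ _ (fun z => r * (c * (rot t z).1 + d * (rot t z).2 - 1) : R^o) u p v uE).
  rewrite derive_line; under eq_fun do rewrite rot_line/=.
  apply: derive_val; apply: is_derive_eq.
  by rewrite /GRing.scale/=; ring.
rewrite /grad_norm2 !dE !rot_basis.
have cs := cos2Dsin2 t; move: (cos t) (sin t) cs => C S CS.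
transitivity ((C ^+ 2 + S ^+ 2) * (c ^+ 2 + d ^+ 2) * r ^+ 2); first by ring.
by rewrite CS cd !mul1r.
Qed.
End gradients.

(** * The competitor belongs to the class *)

Section competitor_class.
Variables (R : realType) (M rho q b theta : R) (u : plane R -> R).
Hypothesis M0 : 0 < M.
Hypothesis rho0 : 0 < rho.
Hypothesis rhoq : rho < q.
Hypothesis qb : q < b.
Hypothesis b1 : b < 1.
Hypothesis Cu : C_ M u.
Local Notation U := (framed theta u).
Hypothesis U_ge : forall c d x y, c ^+ 2 + d ^+ 2 = 1 -> b <= c ->
  x ^+ 2 + y ^+ 2 <= 1 -> M / (1 - rho * c) * (c * x + d * y - 1) <= U x y.
Hypothesis U_ray : forall t c d, 0 <= t <= 1 -> c ^+ 2 + d ^+ 2 = 1 ->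
  U (rho + t * (c - rho)) (t * d) <= M * (t - 1).

Definition plane_competitor (p : plane R) : R :=
  competitor M rho q b U (rot theta p).1 (rot theta p).2.

Lemma rotK (p : plane R) : rot (- theta) (rot theta p) = p.
Proof.
rewrite -[LHS]/((rot (- theta) \o rot theta) p) rotD addNr /rot cos0 sin0.
by case: p => x y /=; congr (_, _); rewrite ?mulr1 ?mulr0 ?addr0// add0r.
Qed.

Lemma framedK (p : plane R) : U (rot theta p).1 (rot theta p).2 = u p.
Proof. by rewrite /framed -surjective_pairing rotK. Qed.

Lemma Omega_rot (p : plane R) :
  Omega p = ((rot theta p).1 ^+ 2 + (rot theta p).2 ^+ 2 <= 1) :> Prop.
Proof. by rewrite -(OmegaE theta) -surjective_pairing rotK. Qed.

Lemma framed_convex (t x y x' y' : R) : 0 <= t <= 1 ->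
  x ^+ 2 + y ^+ 2 <= 1 -> x' ^+ 2 + y' ^+ 2 <= 1 ->
  U (t * x + (1 - t) * x') (t * y + (1 - t) * y') <=
  t * U x y + (1 - t) * U x' y'.
Proof.
move=> /andP[t0 t1]; rewrite -!(OmegaE theta) => p p'.
have [_ cu _] := Cu.
have := cu (Itv01 t0 t1) (rot (- theta) (x, y)) (rot (- theta) (x', y')).
rewrite !inE => /(_ p p'); rewrite !convE/= /framed.
have -> : rot (- theta) (t * x + (1 - t) * x', t * y + (1 - t) * y') =
   t *: (rot (- theta) (x, y) : plane R) + (1 - t) *: (rot (- theta) (x', y') : plane R).
  by apply: injective_projections; rewrite /rot/= /GRing.scale/=; ring.
by [].
Qed.

Lemma plane_competitor_le (p : plane R) : Omega p -> plane_competitor p <= u p.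
Proof.
rewrite Omega_rot => hp; rewrite -framedK.
exact: (competitor_le M0 rho0 rhoq qb b1 U_ge U_ray framed_convex hp).
Qed.

Lemma framed_le0 (x y : R) : x ^+ 2 + y ^+ 2 <= 1 -> U x y <= 0.
Proof. by rewrite -(OmegaE theta) => hp; have [/(_ _ hp)/andP[]] := Cu. Qed.

Lemma framed_geM (x y : R) : x ^+ 2 + y ^+ 2 <= 1 -> - M <= U x y.
Proof. by rewrite -(OmegaE theta) => hp; have [/(_ _ hp)/andP[]] := Cu. Qed.

Lemma plane_competitor_convex : convex_function (@Omega R) plane_competitor.
Proof.
move=> l x y; rewrite !inE => hx hy; rewrite !convE.
have l01 : 0 <= l%:num <= 1 by rewrite ge0 le1.
move: hx hy; rewrite !Omega_rot => hx hy.
have := competitor_convex M0 rho0 rhoq qb b1 U_ge U_ray framed_le0 framed_convex l01 hx hy.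
rewrite /plane_competitor.
have -> : rot theta (l%:num *: (x : plane R) + (1 - l%:num) *: (y : plane R)) =
  (l%:num * (rot theta x).1 + (1 - l%:num) * (rot theta y).1,
   l%:num * (rot theta x).2 + (1 - l%:num) * (rot theta y).2).
  by apply: injective_projections; rewrite /rot/= /GRing.scale/=; ring.
by [].
Qed.

Lemma continuous_rot1 : continuous (fun p : plane R => (rot theta p).1 : R^o).
Proof.
move=> p; apply: cvgD; apply: cvgM; try exact: cvg_cst;
  [exact: cvg_fst|exact: cvg_snd].
Qed.

Lemma continuous_rot2 : continuous (fun p : plane R => (rot theta p).2 : R^o).
Proof.
move=> p; apply: cvgD; apply: cvgM; try exact: cvg_cst;
  [apply: cvgN; exact: cvg_fst|exact: cvg_snd].
Qed.

Lemma continuous_gauge (a : R) :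
  continuous (fun p : plane R => gauge a (rot theta p).1 (rot theta p).2 : R^o).
Proof.
move=> p; rewrite /gauge; apply: cvgM; last exact: cvg_cst.
have cx : (rot theta z).1 - a @[z --> p] --> (rot theta p).1 - a.
  by apply: cvgB; [exact: continuous_rot1|exact: cvg_cst].
apply: cvgD; first by apply: cvgM => //; exact: cvg_cst.
apply: (@cvg_comp _ _ _ _ (@Num.sqrt R)); last exact: sqrt_continuous.
apply: cvgD; first by apply: (@cvg_comp _ _ _ _ (fun x : R => x ^+ 2)); [exact: cx|exact: exprn_continuous].
apply: cvgM; first exact: cvg_cst.
by apply: (@cvg_comp _ _ _ _ (fun x : R => x ^+ 2)); [exact: continuous_rot2|exact: exprn_continuous].
Qed.

(** Nonnegative exactly on the wedge that cuts the sector out of the disk. *)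
Definition margin (a : R) (p : plane R) : R :=
  Num.sqrt (1 - b ^+ 2) * ((rot theta p).1 - a) - (b - a) * `|(rot theta p).2|.

Lemma continuous_margin (a : R) : continuous (margin a : plane R -> R^o).
Proof.
move=> p; apply: cvgB; apply: cvgM; try exact: cvg_cst.
  by apply: cvgB; [exact: continuous_rot1|exact: cvg_cst].
by apply: cvg_norm; exact: continuous_rot2.
Qed.

Lemma continuous_roof : continuous (fun p : plane R =>
  side_slope M rho b * (b * (rot theta p).1 +
    Num.sqrt (1 - b ^+ 2) * `|(rot theta p).2| - 1) : R^o).
Proof.
move=> p; apply: cvgM; first exact: cvg_cst.
apply: cvgB; last exact: cvg_cst.
apply: cvgD; apply: cvgM; try exact: cvg_cst; first exact: continuous_rot1.
by apply: cvg_norm; exact: continuous_rot2.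
Qed.

Lemma closed_sector_margin (a : R) (p : plane R) : Omega p ->
  closed_sector a b (rot theta p).1 (rot theta p).2 = (0 <= margin a p).
Proof. by rewrite Omega_rot /closed_sector => -> /=; rewrite subr_ge0. Qed.

(** The new cone, the flat triangles and [u] are lower semicontinuous, and their
    domains are cut out by closed conditions in this order. Where one domain
    ends, the next piece is not smaller: the triangles have the same value as
    the new cone, and [u] is never below the competitor. *)
Lemma plane_competitor_lsc :
  lower_semicontinuous (EFin \o plane_competitor : subspace (@Omega R) -> \bar R).
Proof.
move=> x a; rewrite /= lte_fin => ax.
have [Ox|nOx] := pselect (Omega (x : plane R)); last first.
  exists [set x]; last by move=> _ ->; rewrite lte_fin.
  by case: (nbhs_subspaceP (@Omega R) x) => // _ _ ->.
have [_ _ /(_ x a)] := Cu; rewrite /= lte_fin.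
move=> /(_ (lt_le_trans ax (plane_competitor_le Ox))) [V nV aV].
have {}nV : within (@Omega R) (nbhs (x : plane R)) V by move: nV; case: (nbhs_subspaceP (@Omega R) x).
pose f1 (p : plane R) := apex_depth M rho q b * (gauge q (rot theta p).1 (rot theta p).2 - 1).
pose f2 (p : plane R) := side_slope M rho b * (b * (rot theta p).1 +
    Num.sqrt (1 - b ^+ 2) * `|(rot theta p).2| - 1).
have c1 : continuous (f1 : plane R -> R^o).
  move=> p; apply: cvgM; first exact: cvg_cst.
  by apply: cvgB; [exact: continuous_gauge|exact: cvg_cst].
have c2 : continuous (f2 : plane R -> R^o) by exact: continuous_roof.
have vE p : Omega p -> plane_competitor p =
    if 0 <= margin q p then f1 p else if 0 <= margin rho p then f2 p else u p.
  by move=> Op; rewrite /plane_competitor /competitor !closed_sector_margin// framedK.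
have h1 : \forall y \near (x : plane R), 0 <= margin q y -> a < f1 y.
  have [m0|m0] := leP 0 (margin q x).
    have : a < f1 x by move: ax; rewrite vE// m0.
    by move=> /(cvgr_gt _ (@c1 x)); apply: filterS => y + _.
  have : \forall y \near (x : plane R), margin q y < 0.
    exact: (cvgr_lt _ (@continuous_margin q x) _ m0).
  by apply: filterS => y my; rewrite leNgt my.
have h2 : \forall y \near (x : plane R), ~~ (0 <= margin q y) -> 0 <= margin rho y -> a < f2 y.
  have [m0|m0|m0] := ltgtP 0 (margin q x).
  - have : \forall y \near (x : plane R), 0 < margin q y.
      exact: (cvgr_gt _ (@continuous_margin q x) _ m0).
    by apply: filterS => y my; rewrite (ltW my).
  - have [r0|r0] := leP 0 (margin rho x).
      have : a < f2 x by move: ax; rewrite vE// leNgt m0/= r0.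
      by move=> /(cvgr_gt _ (@c2 x)); apply: filterS => y + _ _.
    have : \forall y \near (x : plane R), margin rho y < 0.
      exact: (cvgr_lt _ (@continuous_margin rho x) _ r0).
    by apply: filterS => y my _; rewrite leNgt my.
  - have f12 : f1 x = f2 x.
      apply: (competitor_edge M rho0 rhoq qb b1).
      by apply/esym/eqP; rewrite -subr_eq0 -/(margin q x) -m0.
    have : a < f2 x by move: ax; rewrite vE// -m0 lexx f12.
    by move=> /(cvgr_gt _ (@c2 x)); apply: filterS => y + _ _.
exists [set y | a < plane_competitor y]; last by move=> y /=; rewrite lte_fin.
case: (nbhs_subspaceP (@Omega R) x) => // _.
have {}nV : \forall y \near (x : plane R), Omega y -> V y by exact: nV.
suff : \forall y \near (x : plane R), Omega y -> a < plane_competitor y by [].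
apply: filterS3 nV h1 h2 => y Vy a1 a2 Oy.
rewrite vE//; case: ifPn => [/a1//|/a2 {}a2]; case: ifPn => [/a2//|_].
by rewrite -lte_fin; apply: aV; exact: Vy.
Qed.

Lemma C_competitor : C_ M plane_competitor.
Proof.
split; [|exact: plane_competitor_convex|exact: plane_competitor_lsc].
move=> p Op; have := Op; rewrite Omega_rot => hp.
apply/andP; split.
  exact: (competitor_geM M0 rho0 rhoq qb b1 U_ray framed_le0 framed_geM hp).
apply: le_trans (plane_competitor_le Op) _.
by have [/(_ _ Op)/andP[]] := Cu.
Qed.

End competitor_class.

(** * The gain in each direction *)

Section pointwise_gain.
Variables (R : realType) (M rho q b : R).
Hypothesis M0 : 0 < M.
Hypothesis rho0 : 0 < rho.
Hypothesis rhoq : rho < q.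
Hypothesis q1 : q < 1.
Hypothesis b1 : b < 1.
Hypothesis gain : rho * (1 - q * b) ^+ 3 < q * (1 - q) ^+ 3.

(** With [x = (1 - q * b) / (1 - q * c)] and
    [y = (1 - rho * b) / (1 - rho * c)], so that [1 < y <= x], and [r] the
    side slope, subtracting the values at slope [r] leaves the comparison of
    [rho * (y + 1) / ((r * y) ^+ 2 + 1)] with
    [q * (x + 1) / ((r * x) ^+ 2 + 1)]. As the opening shrinks, [x] and [y] tend to
    [1], so [rho < q] decides; the hypothesis [gain] says that the opening is
    small enough, with a bound that does not involve [r]. *)
Lemma density_gain (c : R) : b < c <= 1 ->
  (1 - q * c) / ((apex_depth M rho q b / (1 - q * c)) ^+ 2 + 1) +
  (1 - rho * c) / (side_slope M rho b ^+ 2 + 1) <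
  (1 - rho * c) / ((M / (1 - rho * c)) ^+ 2 + 1) +
  (1 - q * c) / (side_slope M rho b ^+ 2 + 1).
Proof.
move=> /andP[bc c1]; have q0 : 0 < q by exact: lt_trans rhoq.
have A0 : 1 - q <= 1 - q * c by rewrite lerD2l lerN2 ler_piMr// ltW.
have q1' : 0 < 1 - q by rewrite subr_gt0.
have Ap : 0 < 1 - q * c by exact: lt_le_trans A0.
have rho1 : rho < 1 by exact: lt_trans q1.
have Bp : 0 < 1 - rho * c.
  by rewrite subr_gt0; apply: le_lt_trans rho1; rewrite ler_piMr// ltW.
have AA : 1 - q * c < 1 - q * b by rewrite ltrD2l ltrN2 ltr_pM2l.
have BB : 1 - rho * c < 1 - rho * b by rewrite ltrD2l ltrN2 ltr_pM2l.
have Bp' : 0 < 1 - rho * b by exact: lt_trans BB.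
have r0 : 0 < side_slope M rho b by exact: divr_gt0.
have ME : M = side_slope M rho b * (1 - rho * b) by rewrite divfK// gt_eqF.
rewrite [X in X / (1 - rho * c)]ME /apex_depth.
move: (side_slope M rho b) r0 => r r0 {ME}.
pose x := (1 - q * b) / (1 - q * c); pose y := (1 - rho * b) / (1 - rho * c).
have xE : x * (1 - q * c) = 1 - q * b by rewrite divfK// gt_eqF.
have yE : y * (1 - rho * c) = 1 - rho * b by rewrite divfK// gt_eqF.
rewrite -!mulrA -/x -/y.
have x1 : 1 < x by rewrite ltr_pdivlMr// mul1r.
have y1 : 1 < y by rewrite ltr_pdivlMr// mul1r.
have yx : y <= x.
  rewrite /y /x ler_pdivrMr// mulrAC ler_pdivlMr//.
  have : 0 <= (q - rho) * (c - b) by rewrite mulr_ge0// subr_ge0 ltW.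
  by lra.
have x3 : rho * x ^+ 3 < q.
  rewrite expr_div_n mulrA ltr_pdivrMr ?exprn_gt0//.
  apply: lt_le_trans gain _; rewrite ler_pM2l//.
  by rewrite lerXn2r// nnegrE ltW.
have key : rho * (y + 1) * ((r * x) ^+ 2 + 1) < q * (x + 1) * ((r * y) ^+ 2 + 1).
  have r2 : 0 < r ^+ 2 by rewrite exprn_gt0.
  apply: (@le_lt_trans _ _ (2 * (rho * x ^+ 3) * (r ^+ 2 + 1))).
    have h1 : (r * x) ^+ 2 + 1 <= x ^+ 2 * (r ^+ 2 + 1).
      have -> : x ^+ 2 * (r ^+ 2 + 1) = (r * x) ^+ 2 + x ^+ 2 by ring.
      by rewrite lerD2l expr_ge1// ltW// (lt_trans _ x1).
    have h2 : rho * (y + 1) <= rho * (2 * x) by rewrite ler_pM2l//; lra.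
    have -> : 2 * (rho * x ^+ 3) * (r ^+ 2 + 1) = rho * (2 * x) * (x ^+ 2 * (r ^+ 2 + 1)) by ring.
    apply: ler_pM => //; last by rewrite addr_ge0// sqr_ge0.
    by rewrite mulr_ge0 ?(ltW rho0)//; lra.
  apply: (@lt_le_trans _ _ (2 * q * (r ^+ 2 + 1))).
    by rewrite ltr_pM2r ?ltr_pM2l// addr_gt0.
  have -> : 2 * q * (r ^+ 2 + 1) = q * 2 * (r ^+ 2 + 1) by ring.
  apply: ler_pM; rewrite ?mulr_ge0 ?addr_ge0 ?sqr_ge0 ?(ltW q0)//.
    by rewrite ler_pM2l//; lra.
  rewrite lerD2r exprMn ler_peMr ?sqr_ge0//.
  by rewrite expr_ge1// ltW// (lt_trans _ y1).
have dx : 0 < (r * x) ^+ 2 + 1 by rewrite ltr_wpDl// sqr_ge0.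
have dy : 0 < (r * y) ^+ 2 + 1 by rewrite ltr_wpDl// sqr_ge0.
have dr : 0 < r ^+ 2 + 1 by rewrite ltr_wpDl// sqr_ge0.
have ex : (1 - q * c) / ((r * x) ^+ 2 + 1) = (1 - q * c) / (r ^+ 2 + 1) -
   r ^+ 2 * (c - b) / (r ^+ 2 + 1) * (q * (x + 1) / ((r * x) ^+ 2 + 1)).
  have -> : r ^+ 2 * (c - b) / (r ^+ 2 + 1) * (q * (x + 1) / ((r * x) ^+ 2 + 1)) =
    r ^+ 2 * (q * (c - b)) * (x + 1) / ((r ^+ 2 + 1) * ((r * x) ^+ 2 + 1)).
    by field; rewrite !gt_eqF.
  have -> : q * (c - b) = (x - 1) * (1 - q * c) by rewrite mulrBl xE; ring.
  by field; rewrite !gt_eqF.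
have ey : (1 - rho * c) / ((r * y) ^+ 2 + 1) = (1 - rho * c) / (r ^+ 2 + 1) -
   r ^+ 2 * (c - b) / (r ^+ 2 + 1) * (rho * (y + 1) / ((r * y) ^+ 2 + 1)).
  have -> : r ^+ 2 * (c - b) / (r ^+ 2 + 1) * (rho * (y + 1) / ((r * y) ^+ 2 + 1)) =
    r ^+ 2 * (rho * (c - b)) * (y + 1) / ((r ^+ 2 + 1) * ((r * y) ^+ 2 + 1)).
    by field; rewrite !gt_eqF.
  have -> : rho * (c - b) = (y - 1) * (1 - rho * c) by rewrite mulrBl yE; ring.
  by field; rewrite !gt_eqF.
rewrite ex ey.
have : r ^+ 2 * (c - b) / (r ^+ 2 + 1) * (rho * (y + 1) / ((r * y) ^+ 2 + 1)) <
       r ^+ 2 * (c - b) / (r ^+ 2 + 1) * (q * (x + 1) / ((r * x) ^+ 2 + 1)).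
  rewrite ltr_pM2l; last by rewrite divr_gt0// mulr_gt0 ?exprn_gt0 ?subr_gt0.
  by rewrite ltr_pdivrMr// mulrAC ltr_pdivlMr.
lra.
Qed.

End pointwise_gain.

(** * Integrals over the arc *)

Section arc_integrals.
Context (R : realType).
Local Notation mu := (@lebesgue_measure R).
Local Notation T := (measurableTypeR R).

Lemma integral_segment_fin (beta : R) (f : R -> R) : continuous f ->
  (\int[mu]_(t in `[(- beta)%R, beta]) (f t)%:E \is a fin_num)%E.
Proof.
move=> cf; apply: integrable_fin_num => //.
apply: continuous_compact_integrable; first exact: segment_compact.
exact: continuous_subspaceT.
Qed.

(** On the middle half of the interval the difference has a positive minimum. *)
Lemma lt_integral_segment (beta : R) (f g : R -> R) : 0 < beta ->
  continuous f -> continuous g -> (forall t, 0 <= f t) ->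
  (forall t, - beta <= t <= beta -> f t <= g t) ->
  (forall t, - beta < t < beta -> f t < g t) ->
  (\int[mu]_(t in `[(- beta)%R, beta]) (f t)%:E <
   \int[mu]_(t in `[(- beta)%R, beta]) (g t)%:E)%E.
Proof.
move=> b0 cf cg f0 fg fg'.
have mf : measurable_fun setT f by exact: continuous_measurable_fun.
have bb : - (beta / 2) <= beta / 2 by lra.
have cfg : {within `[- (beta / 2), beta / 2], continuous (fun t => g t - f t)}.
  by apply: continuous_subspaceT => t; apply: cvgB; [exact: cg|exact: cf].
have [c cb cmin] := EVT_min bb cfg.
have d0 : 0 < g c - f c.
  rewrite subr_gt0; apply: fg'; move: cb; rewrite in_itv/= => /andP[? ?].
  by apply/andP; split; lra.
pose d := g c - f c.
pose k t := d * \1_(`[- (beta / 2), beta / 2]%classic : set R) t.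
have mk : measurable_fun setT k by apply: measurable_funM.
have k0 t : 0 <= k t by rewrite /k mulr_ge0// ltW.
have Ik : (\int[mu]_(t in `[(- beta)%R, beta]) (k t)%:E = (d * beta)%:E)%E.
  rewrite /k; under eq_integral do rewrite EFinM.
  rewrite ge0_integralZl_EFin//; last 2 first.
  - by apply/measurable_EFinP; exact: measurable_funTS.
  - exact: ltW.
  rewrite integral_indic// setIidl.
    rewrite /= lebesgue_measure_itv/= lte_fin ifT; last by lra.
    by rewrite -EFinB -EFinM; congr (_ * _)%:E; field.
  by apply: subset_itv; rewrite bnd_simp; lra.
apply: (@lt_le_trans _ _ (\int[mu]_(t in `[(- beta)%R, beta]) ((f t)%:E + (k t)%:E)%E)%E).
  rewrite ge0_integralD//=; last 4 first.
  - by move=> t _; rewrite lee_fin.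
  - by apply/measurable_EFinP; exact: measurable_funTS.
  - by move=> t _; rewrite lee_fin.
  - by apply/measurable_EFinP; exact: measurable_funTS.
  by rewrite Ik lteDl ?integral_segment_fin// lte_fin mulr_gt0.
apply: le_ge0_integral => t; first by move=> _; rewrite adde_ge0// lee_fin.
rewrite /= in_itv/= => tb; rewrite -EFinD lee_fin /k indicE.
case: (boolP (t \in _)) => [|_]; last by rewrite mulr0 addr0 fg.
by rewrite inE/= => /cmin; rewrite /d mulr1; lra.
Qed.

Definition cone_density (a H m : R) : R := (cone_slope a H m ^+ 2 + 1)^-1.

(** The contribution of the direction [t] of the cone with apex [(a, 0)] at
    depth [H]: area of the infinitesimal sector times [1 / (s ^+ 2 + 1)] for
    the slope [s = H / (1 - a * cos t)]. *)
Definition arc_density (a H t : R) : R :=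
  (1 - a * cos t) / ((H / (1 - a * cos t)) ^+ 2 + 1) / 2.

Lemma continuous_cone_density (a H : R) : 0 < a < 1 -> continuous (cone_density a H).
Proof.
move=> /andP[a0 a1] m; have D0 : 0 < 1 - a ^+ 2 by nra.
have q0 : 0 < 1 + (1 - a ^+ 2) * m ^+ 2.
  by rewrite ltr_wpDr// mulr_ge0 ?sqr_ge0// ltW.
apply: cvgV; first by rewrite gt_eqF// ltr_wpDl// sqr_ge0.
apply: cvgD; last exact: cvg_cst.
apply: (@cvg_comp _ _ _ _ (fun x : R => x ^+ 2)); last exact: exprn_continuous.
apply: cvgM; last exact: cvg_cst.
apply: cvgM; first exact: cvg_cst.
apply: cvgD; first exact: cvg_cst.
apply: cvgM; first exact: cvg_cst.
apply: cvgV; first by rewrite gt_eqF// sqrtr_gt0.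
apply: (@cvg_comp _ _ _ _ (@Num.sqrt R)); last exact: sqrt_continuous.
apply: cvgD; first exact: cvg_cst.
by apply: cvgM; [exact: cvg_cst|exact: exprn_continuous].
Qed.

Lemma ocos_gt0 (a t : R) : 0 < a < 1 -> 0 < 1 - a * cos t.
Proof.
move=> /andP[a0 a1]; rewrite subr_gt0; apply: le_lt_trans a1.
by rewrite ler_piMr ?cos_le1// ltW.
Qed.

Lemma continuous_arc_density (a H : R) : 0 < a < 1 -> continuous (arc_density a H).
Proof.
move=> a01 t; have oc := ocos_gt0 t a01.
have cc : 1 - a * cos x @[x --> t] --> 1 - a * cos t.
  apply: cvgB; first exact: cvg_cst.
  by apply: cvgM; [exact: cvg_cst|exact: continuous_cos].
apply: cvgM; last exact: cvg_cst.
apply: cvgM; first exact: cc.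
apply: cvgV; first by rewrite gt_eqF// ltr_wpDl// sqr_ge0.
apply: cvgD; last exact: cvg_cst.
apply: (@cvg_comp _ _ _ _ (fun x : R => x ^+ 2)); last exact: exprn_continuous.
apply: cvgM; first exact: cvg_cst.
by apply: cvgV; rewrite ?gt_eqF.
Qed.

Lemma arc_density_ge0 (a H t : R) : 0 < a < 1 -> 0 <= arc_density a H t.
Proof.
move=> a01; have oc := ocos_gt0 t a01.
by apply: divr_ge0 => //; apply: divr_ge0; [exact: ltW|rewrite addr_ge0// sqr_ge0].
Qed.

Lemma cone_slope_arc (a H t : R) : 0 < a < 1 -> a < cos t ->
  cone_slope a H (slope a t) = H / (1 - a * cos t).
Proof.
move=> a01 act; have oc := ocos_gt0 t a01.
have [a0 a1] := andP a01.
have d0 : 0 < cos t - a by rewrite subr_gt0.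
have D0 : 0 < 1 - a ^+ 2 by nra.
rewrite /cone_slope /slope.
have -> : 1 + (1 - a ^+ 2) * (sin t / (cos t - a)) ^+ 2 =
    ((1 - a * cos t) / (cos t - a)) ^+ 2.
  have -> : (sin t / (cos t - a)) ^+ 2 = (1 - cos t ^+ 2) / (cos t - a) ^+ 2.
    by rewrite -(cos2Dsin2 t) addrAC subrr add0r expr_div_n.
  by field; rewrite gt_eqF.
rewrite sqrtr_sqr ger0_norm; last by rewrite divr_ge0// ltW.
by field; rewrite !gt_eqF.
Qed.

Lemma integral_sector_density (a H beta : R) :
  0 < a -> 0 < beta < pi -> a < cos beta ->
  (\int[mu \x mu]_p (if open_sector a (cos beta) p then
     (cone_density a H (p.2 / (p.1 - a)))%:E else 0) =
  \int[mu]_(t in `[(- beta)%R, beta]) (arc_density a H t)%:E)%E.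
Proof.
move=> a0 b0 ab.
have a01 : 0 < a < 1 by rewrite a0 (lt_le_trans ab)// cos_le1.
rewrite (integral_sector (Psi := cone_density a H))//; last 2 first.
- exact: continuous_cone_density.
- by move=> m; rewrite invr_ge0 addr_ge0// sqr_ge0.
apply: eq_integral => t; rewrite inE/= in_itv/= => tb; congr (_%:E).
have [/ltW b0' /ltW bpi] := andP b0.
have act : a < cos t.
  by apply: lt_le_trans ab _; apply: le_cos_itv => //; rewrite b0'.
by rewrite /cone_density cone_slope_arc// /arc_density; rewrite mulrCA mulrA.
Qed.

Lemma integral_sector_cst (a k beta : R) :
  0 < a -> 0 < beta < pi -> a < cos beta -> 0 <= k ->
  (\int[mu \x mu]_p (if open_sector a (cos beta) p then k%:E else 0) =
  \int[mu]_(t in `[(- beta)%R, beta]) (k * ((1 - a * cos t) / 2))%:E)%E.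
Proof.
move=> a0 b0 ab k0; rewrite -(integral_sector (Psi := fun=> k))//.
by move=> m; exact: cvg_cst.
Qed.

End arc_integrals.

(** * Null sets *)

Section null_curves.
Context (R : realType).
Local Notation mu := (@lebesgue_measure R).
Local Notation T := (measurableTypeR R).

Lemma integral_finite_sections (N : T * T -> bool) :
  measurable_fun setT N ->
  (forall x, exists s : seq R, forall y, N (x, y) -> y \in s) ->
  (\int[mu \x mu]_p (if N p then 1 else 0) = 0)%E.
Proof.
move=> mN fN; rewrite fubini_tonelli1; last 2 first.
- by apply: measurable_fun_ifT.
- by move=> p; case: ifP.
apply: integral0_eq => x _; rewrite /fubini_F/=.
have [s sP] := fN x.
have cs : countable ([set` s] : set T).
  by apply: finite_set_countable; exact: finite_seq.
have ms : measurable ([set` s] : set T) by exact: countable_measurable.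
apply/eqP; rewrite eq_le integral_ge0 ?andbT; last by move=> y _; case: ifP.
apply: (@le_trans _ _ (\int[mu]_(y in [set` s]) cst 1 y)%E); last first.
  rewrite integral_cst// mul1e le_eqVlt; apply/orP; left; apply/eqP.
  exact: countable_lebesgue_measure0.
rewrite [leRHS]integral_mkcond; apply: le_ge0_integral => y _; first by case: ifP.
rewrite /patch; case: ifPn => [/sP ys|_]; first by rewrite mem_set.
by case: ifP => _ //=; exact: lee01.
Qed.

End null_curves.

(** * Gradients of the function and of the competitor *)

Section local_gradients.
Variables (R : realType) (M rho q b theta : R) (u : plane R -> R).
Hypothesis rho0 : 0 < rho.
Hypothesis rhoq : rho < q.
Hypothesis qb : q < b.
Hypothesis b1 : b < 1.
Local Notation U := (framed theta u).
Hypothesis U_ge : forall c d x y, c ^+ 2 + d ^+ 2 = 1 -> b <= c ->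
  x ^+ 2 + y ^+ 2 <= 1 -> M / (1 - rho * c) * (c * x + d * y - 1) <= U x y.
Hypothesis U_ray : forall t c d, 0 <= t <= 1 -> c ^+ 2 + d ^+ 2 = 1 ->
  U (rho + t * (c - rho)) (t * d) <= M * (t - 1).
Local Notation v := (plane_competitor M rho q b theta u).
Local Notation mg := (margin b theta).

Let q1 : q < 1. Proof. exact: lt_trans b1. Qed.
Let q0 : 0 < q. Proof. exact: lt_trans rhoq. Qed.
Let q01 : 0 < q < 1. Proof. by rewrite q0. Qed.
Let rho01 : 0 < rho < 1. Proof. by rewrite rho0 (lt_trans rhoq). Qed.

Definition radius2 (p : plane R) : R := (rot theta p).1 ^+ 2 + (rot theta p).2 ^+ 2.

Lemma continuous_radius2 : continuous (radius2 : plane R -> R^o).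
Proof.
move=> p; apply: cvgD;
  apply: (@cvg_comp _ _ _ _ (fun x : R => x ^+ 2)); try exact: exprn_continuous.
  exact: continuous_rot1.
exact: continuous_rot2.
Qed.

Lemma near_lt (f : plane R -> R) (p : plane R) (c : R) :
  continuous (f : plane R -> R^o) -> f p < c -> \forall z \near p, f z < c.
Proof. by move=> cf; exact: (cvgr_lt _ (cf p)). Qed.

Lemma near_gt (f : plane R -> R) (p : plane R) (c : R) :
  continuous (f : plane R -> R^o) -> c < f p -> \forall z \near p, c < f z.
Proof. by move=> cf; exact: (cvgr_gt _ (cf p)). Qed.

Lemma open_sectorE (a : R) (p : plane R) :
  open_sector a b (rot theta p) = (radius2 p < 1) && (0 < mg a p).
Proof. by rewrite /open_sector /margin subr_gt0. Qed.

Lemma closed_sectorE (a : R) (p : plane R) :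
  closed_sector a b (rot theta p).1 (rot theta p).2 = (radius2 p <= 1) && (0 <= mg a p).
Proof. by rewrite /closed_sector /margin subr_ge0. Qed.

Lemma closed_sector_sub (x y : R) : closed_sector q b x y -> closed_sector rho b x y.
Proof.
move=> h; have /andP[h1 h2] := h; rewrite /closed_sector h1/=.
have qb' : q < b < 1 by rewrite qb.
have ys := closed_sector_height q0 qb' h.
have : 0 <= (q - rho) * (Num.sqrt (1 - b ^+ 2) - `|y|).
  by rewrite mulr_ge0// subr_ge0// ltW.
by move: h2; lra.
Qed.

(** The sector is closed, so off it both functions agree on a neighbourhood and
    have the same directional derivatives, existing or not. *)
Lemma grad_outside (p : plane R) :
  ~~ closed_sector rho b (rot theta p).1 (rot theta p).2 ->
  grad_norm2 v p = grad_norm2 u p.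
Proof.
move=> np; have nearE : \forall z \near p, v z = u z.
  have : \forall z \near p, ~~ closed_sector rho b (rot theta z).1 (rot theta z).2.
    move: np; rewrite closed_sectorE negb_and -!ltNge => /orP[h|h].
      have := near_gt continuous_radius2 h.
      by apply: filterS => z hz; rewrite closed_sectorE negb_and -!ltNge hz.
    have := near_lt (@continuous_margin R b theta rho) h.
    by apply: filterS => z hz; rewrite closed_sectorE negb_and -!ltNge hz orbT.
  apply: filterS => z hz; rewrite /plane_competitor /competitor (negbTE hz).
  by rewrite ifF ?framedK//; apply: contraNF hz; exact: closed_sector_sub.
by rewrite /grad_norm2 !(near_eq_derive _ nearE).
Qed.

Lemma near_open_sector (a : R) (p : plane R) : open_sector a b (rot theta p) ->
  \forall z \near p, closed_sector a b (rot theta z).1 (rot theta z).2.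
Proof.
rewrite open_sectorE => /andP[h1 h2].
have n1 := near_lt continuous_radius2 h1.
have n2 := near_gt (@continuous_margin R b theta a) h2.
by apply: filterS2 n1 n2 => z z1 z2; rewrite closed_sectorE !ltW.
Qed.

Let sector_right (a : R) (p : plane R) : a < b -> open_sector a b (rot theta p) ->
  a < (rot theta p).1.
Proof.
move=> ab /andP[_ h].
have s0 : 0 < Num.sqrt (1 - b ^+ 2).
  by rewrite sqrtr_gt0; move: (lt_trans q0 qb) b1; nra.
have : 0 < Num.sqrt (1 - b ^+ 2) * ((rot theta p).1 - a).
  by apply: le_lt_trans h; rewrite mulr_ge0// subr_ge0 ltW.
by rewrite pmulr_rgt0// subr_gt0.
Qed.

Lemma grad_profile (p : plane R) : open_sector rho b (rot theta p) ->
  grad_norm2 u p = cone_slope rho M ((rot theta p).2 / ((rot theta p).1 - rho)) ^+ 2.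
Proof.
move=> h; apply: grad_norm2_cone => //; first by apply: sector_right h; exact: lt_trans qb.
have := near_open_sector h; apply: filterS => z hz.
by rewrite -(framedK theta u) (profile_sector rho0 rhoq qb b1 U_ge U_ray hz).
Qed.

Lemma grad_competitor_cone (p : plane R) : open_sector q b (rot theta p) ->
  grad_norm2 v p = cone_slope q (apex_depth M rho q b)
    ((rot theta p).2 / ((rot theta p).1 - q)) ^+ 2.
Proof.
move=> h; apply: grad_norm2_cone => //; first exact: sector_right h.
have := near_open_sector h; apply: filterS => z hz.
by rewrite /plane_competitor /competitor hz.
Qed.

Lemma grad_competitor_side (p : plane R) : open_sector rho b (rot theta p) ->
  mg q p < 0 -> (rot theta p).2 != 0 ->
  grad_norm2 v p = side_slope M rho b ^+ 2.
Proof.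
move=> h mq y0.
have b0 : 0 < b by exact: lt_trans qb.
have [d [bd dE]] : exists d, b ^+ 2 + d ^+ 2 = 1 /\
    \forall z \near p, d * (rot theta z).2 = Num.sqrt (1 - b ^+ 2) * `|(rot theta z).2|.
  have s2 : b ^+ 2 + Num.sqrt (1 - b ^+ 2) ^+ 2 = 1.
    have b2 : 0 <= 1 - b ^+ 2 by rewrite subr_ge0 expr_le1// ltW.
    by rewrite (sqr_sqrtr b2) addrC subrK.
  have [yn|yp|/eqP] := ltgtP (rot theta p).2 0; last by rewrite (negbTE y0).
    exists (- Num.sqrt (1 - b ^+ 2)); split; first by rewrite sqrrN.
    have := near_lt (@continuous_rot2 R theta) yn.
    by apply: filterS => z z0; rewrite ltr0_norm// mulrN mulNr.
  exists (Num.sqrt (1 - b ^+ 2)); split=> //.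
  have := near_gt (@continuous_rot2 R theta) yp.
  by apply: filterS => z z0; rewrite gtr0_norm.
apply: (grad_norm2_affine (t := theta) (c := b) (d := d)) => //.
have n1 := near_open_sector h.
have n2 := near_lt (@continuous_margin R b theta q) mq.
apply: filterS3 dE n1 n2 => z dz cz mz.
rewrite /plane_competitor /competitor cz dz ifF//.
by rewrite closed_sectorE [0 <= _]leNgt mz andbF.
Qed.

End local_gradients.

(** * Comparison of the resistances *)

Section comparison.
Variables (R : realType) (M rho q beta theta : R) (u : plane R -> R).
Local Notation mu := (@lebesgue_measure R).
Local Notation T := (measurableTypeR R).
Local Notation b := (cos beta).
Hypothesis M0 : 0 < M.
Hypothesis rho0 : 0 < rho.
Hypothesis rhoq : rho < q.
Hypothesis qb : q < b.
Hypothesis beta0 : 0 < beta < pi.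
Hypothesis gain : rho * (1 - q * b) ^+ 3 < q * (1 - q) ^+ 3.
Local Notation U := (framed theta u).
Hypothesis U_ge : forall c d x y, c ^+ 2 + d ^+ 2 = 1 -> b <= c ->
  x ^+ 2 + y ^+ 2 <= 1 -> M / (1 - rho * c) * (c * x + d * y - 1) <= U x y.
Hypothesis U_ray : forall t c d, 0 <= t <= 1 -> c ^+ 2 + d ^+ 2 = 1 ->
  U (rho + t * (c - rho)) (t * d) <= M * (t - 1).
Local Notation v := (plane_competitor M rho q b theta u).
Local Notation h := (apex_depth M rho q b).
Local Notation r := (side_slope M rho b).

Let b1 : b < 1.
Proof.
have /andP[b0 bpi] := beta0.
by rewrite -(@cos0 R) ltr_cos// in_itv/= ?lexx ?pi_ge0//; rewrite !ltW.
Qed.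
Let q1 : q < 1. Proof. exact: lt_trans b1. Qed.
Let q0 : 0 < q. Proof. exact: lt_trans rhoq. Qed.
Let q01 : 0 < q < 1. Proof. by rewrite q0. Qed.
Let rho1 : rho < 1. Proof. exact: lt_trans q1. Qed.
Let rho01 : 0 < rho < 1. Proof. by rewrite rho0. Qed.
Let rhob : rho < b. Proof. exact: lt_trans qb. Qed.

Definition side_density : R := (r ^+ 2 + 1)^-1.
Local Notation F := side_density.

Let F0 : 0 <= F. Proof. by rewrite invr_ge0 addr_ge0// sqr_ge0. Qed.

Definition profile_density (z : T * T) : \bar R :=
  if open_sector rho b z then (cone_density rho M (z.2 / (z.1 - rho)))%:E else 0%E.

Definition cone_part (z : T * T) : \bar R :=
  if open_sector q b z then (cone_density q h (z.2 / (z.1 - q)))%:E else 0%E.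

Definition sector_part (a : R) (z : T * T) : \bar R :=
  if open_sector a b z then F%:E else 0%E.

Definition competitor_density (z : T * T) : \bar R :=
  if open_sector q b z then (cone_density q h (z.2 / (z.1 - q)))%:E
  else sector_part rho z.

(** The unit circle and the lines where the pieces of the competitor meet. *)
Definition edges (z : T * T) : bool :=
  [|| z.1 ^+ 2 + z.2 ^+ 2 == 1,
      (b - rho) * `|z.2| == Num.sqrt (1 - b ^+ 2) * (z.1 - rho),
      (b - q) * `|z.2| == Num.sqrt (1 - b ^+ 2) * (z.1 - q) | z.2 == 0].

Lemma measurable_ratio (a : R) :
  measurable_fun setT (fun z : T * T => z.2 / (z.1 - a) : R).
Proof.
apply: measurable_funM; first exact: measurable_snd.
apply: (measurableT_comp (@measurable_inv R)).
by apply: measurable_funB => //; exact: measurable_fst.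
Qed.

Lemma measurable_cone (a H : R) : 0 < a < 1 -> measurable_fun setT (fun z : T * T =>
  if open_sector a b z then (cone_density a H (z.2 / (z.1 - a)))%:E else 0%E).
Proof.
move=> a01; apply: measurable_fun_ifT => //; first exact: measurable_open_sector.
apply/measurable_EFinP.
apply: (measurableT_comp (f := cone_density a H)); last exact: measurable_ratio.
by apply: continuous_measurable_fun; exact: continuous_cone_density.
Qed.

Lemma measurable_sector_part (a : R) : measurable_fun setT (sector_part a).
Proof. by apply: measurable_fun_ifT => //; exact: measurable_open_sector. Qed.

Lemma measurable_competitor_density : measurable_fun setT competitor_density.
Proof.
apply: measurable_fun_ifT; [exact: measurable_open_sector| |exact: measurable_sector_part].
apply/measurable_EFinP.
apply: (measurableT_comp (f := cone_density q h)); last exact: measurable_ratio.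
by apply: continuous_measurable_fun; exact: continuous_cone_density.
Qed.

Lemma measurable_edges : measurable_fun setT edges.
Proof.
have m1 : measurable_fun setT (fun z : T * T => z.1 : R) by exact: measurable_fst.
have m2 : measurable_fun setT (fun z : T * T => z.2 : R) by exact: measurable_snd.
have m3 : measurable_fun setT (fun z : T * T => `|z.2| : R) by exact: measurableT_comp.
have mm a : measurable_fun setT (fun z : T * T =>
    (b - a) * `|z.2| == Num.sqrt (1 - b ^+ 2) * (z.1 - a)).
  apply: measurable_fun_eqr; first exact: measurable_funM.
  by apply: measurable_funM => //; exact: measurable_funB.
apply: measurable_or.
  by apply: measurable_fun_eqr => //; apply: measurable_funD; exact: measurable_funX.
apply: measurable_or; first exact: mm.
apply: measurable_or; first exact: mm.
exact: measurable_fun_eqr.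
Qed.

Lemma edges_null : (\int[mu \x mu]_z (if edges z then 1 else 0) = 0)%E.
Proof.
apply: integral_finite_sections; first exact: measurable_edges.
move=> x; pose s := Num.sqrt (1 - b ^+ 2).
pose l := [:: Num.sqrt (1 - x ^+ 2); s * (x - rho) / (b - rho); s * (x - q) / (b - q); 0].
exists (l ++ map -%R l) => y hy.
have hl : `|y| \in l.
  move: hy; rewrite /edges/= => /or4P[/eqP e|/eqP e|/eqP e|/eqP ->].
  - have -> : `|y| = Num.sqrt (1 - x ^+ 2) by rewrite -e addrAC subrr add0r sqrtr_sqr.
    by rewrite !inE eqxx.
  - have -> : `|y| = s * (x - rho) / (b - rho).
      by rewrite -e mulrAC divff ?mul1r// subr_eq0 gt_eqF.
    by rewrite !inE eqxx orbT.
  - have -> : `|y| = s * (x - q) / (b - q).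
      by rewrite -e mulrAC divff ?mul1r// subr_eq0 gt_eqF.
    by rewrite !inE eqxx !orbT.
  - by rewrite normr0 !inE eqxx !orbT.
rewrite mem_cat; have [y0|y0] := ger0P y.
  by rewrite ger0_norm// in hl; rewrite hl.
apply/orP; right; apply/mapP; exists `|y| => //.
by rewrite ltr0_norm// opprK.
Qed.

Lemma open_sector_sub (z : T * T) : open_sector q b z -> open_sector rho b z.
Proof.
move=> /andP[z1 z2]; rewrite /open_sector z1/=.
have hz : closed_sector q b z.1 z.2 by rewrite /closed_sector !ltW.
have qb' : q < b < 1 by rewrite qb.
have ys := closed_sector_height q0 qb' hz.
have : 0 <= (q - rho) * (Num.sqrt (1 - b ^+ 2) - `|z.2|).
  by rewrite mulr_ge0// subr_ge0// ltW.
by move: z2; lra.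
Qed.

(** The flat triangles fill the difference of the two sectors. Adding the
    resistance of the new sector at the side slope to both sides turns their
    contribution into an integral over the arc as well. *)
Lemma integral_density_lt :
  (\int[mu \x mu]_z competitor_density z < \int[mu \x mu]_z profile_density z)%E.
Proof.
have cd0 H a m : (0 <= (cone_density a H m)%:E)%E.
  by rewrite lee_fin invr_ge0 addr_ge0// sqr_ge0.
have g0 z : (0 <= competitor_density z)%E.
  by rewrite /competitor_density /sector_part; do 2 case: ifP => // _.
have s0 a z : (0 <= sector_part a z)%E by rewrite /sector_part; case: ifP.
have c0 z : (0 <= cone_part z)%E by rewrite /cone_part; case: ifP.
have split : (\int[mu \x mu]_z competitor_density z + \int[mu \x mu]_z sector_part q z =
   \int[mu \x mu]_z cone_part z + \int[mu \x mu]_z sector_part rho z)%E.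
  rewrite -ge0_integralD//; last 2 first.
  - exact: measurable_competitor_density.
  - exact: measurable_sector_part.
  rewrite -ge0_integralD//; last 2 first.
  - exact: measurable_cone.
  - exact: measurable_sector_part.
  apply: eq_integral => z _; rewrite /competitor_density /cone_part /sector_part.
  case: ifPn => hq; last by rewrite adde0 add0e.
  by rewrite open_sector_sub.
have oc a t : 0 < a < 1 -> 0 <= F * ((1 - a * cos t) / 2).
  by move=> a01; rewrite mulr_ge0// divr_ge0// ltW// ocos_gt0.
have coc a : continuous (fun t => F * ((1 - a * cos t) / 2)).
  move=> t; apply: cvgM; first exact: cvg_cst.
  apply: cvgM; last exact: cvg_cst.
  apply: cvgB; first exact: cvg_cst.
  by apply: cvgM; [exact: cvg_cst|exact: continuous_cos].
have moc a : measurable_fun (`[(- beta)%R, beta]%classic : set R)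
    (fun t => (F * ((1 - a * cos t) / 2))%:E).
  apply/measurable_EFinP; apply: measurable_funTS.
  exact: continuous_measurable_fun.
have mad a H : 0 < a < 1 -> measurable_fun (`[(- beta)%R, beta]%classic : set R)
    (fun t => (arc_density a H t)%:E).
  move=> a01; apply/measurable_EFinP; apply: measurable_funTS.
  by apply: continuous_measurable_fun; exact: continuous_arc_density.
have Ss a : 0 < a -> a < b -> (\int[mu \x mu]_z sector_part a z =
    \int[mu]_(t in `[(- beta)%R, beta]) (F * ((1 - a * cos t) / 2))%:E)%E.
  by move=> a0 ab; exact: integral_sector_cst.
have Sfin : (\int[mu \x mu]_z sector_part q z)%E \is a fin_num.
  by rewrite Ss//; exact: integral_segment_fin.
rewrite -(lteD2rE _ _ Sfin) split !Ss//.
rewrite /cone_part /profile_density !integral_sector_density//.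
rewrite -ge0_integralD//; last 4 first.
- by move=> t _; rewrite lee_fin arc_density_ge0.
- exact: mad.
- by move=> t _; rewrite lee_fin oc.
- exact: moc.
rewrite -ge0_integralD//; last 4 first.
- by move=> t _; rewrite lee_fin arc_density_ge0.
- exact: mad.
- by move=> t _; rewrite lee_fin oc.
- exact: moc.
have key c : b < c <= 1 -> (1 - q * c) / ((h / (1 - q * c)) ^+ 2 + 1) / 2 + F * ((1 - rho * c) / 2) <
   (1 - rho * c) / ((M / (1 - rho * c)) ^+ 2 + 1) / 2 + F * ((1 - q * c) / 2).
  move=> /(density_gain M0 rho0 rhoq q1 gain) g; rewrite /side_density; lra.
have /andP[be0 bepi] := beta0.
apply: (@lt_integral_segment _ beta (fun t => arc_density q h t + F * ((1 - rho * cos t) / 2))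
  (fun t => arc_density rho M t + F * ((1 - q * cos t) / 2))) => //.
- move=> t; apply: cvgD; [exact: continuous_arc_density|exact: coc].
- move=> t; apply: cvgD; [exact: continuous_arc_density|exact: coc].
- by move=> t; rewrite addr_ge0 ?arc_density_ge0 ?oc.
- move=> t tb.
  have : b <= cos t by apply: le_cos_itv => //; rewrite !ltW.
  rewrite le_eqVlt => /predU1P[bt|bt]; last first.
    by apply/ltW/key; rewrite bt cos_le1.
  have qc : 0 < 1 - q * b by exact: ocos_gt0.
  have rc : 0 < 1 - rho * b by exact: ocos_gt0.
  rewrite /arc_density -bt /side_density /apex_depth mulfK ?gt_eqF//.
  rewrite -/r; lra.
- move=> t tb; apply: key; rewrite cos_le1 andbT.
  by apply: lt_cos_itv => //; rewrite !ltW.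
Qed.

Lemma rotated_integral (g : T * T -> \bar R) : measurable_fun setT g ->
  (forall z, 0 <= g z)%E ->
  (\int[mu \x mu]_p g (rot theta p) = \int[mu \x mu]_z g z)%E.
Proof. by have [_ H] := preserves_area_rot theta; exact: H. Qed.

Definition sector_region : set (T * T) :=
  [set p | closed_sector rho b (rot theta p).1 (rot theta p).2].

Lemma measurable_sector_region : measurable sector_region.
Proof.
pose f (z : T * T) := closed_sector rho b z.1 z.2.
have mf : measurable_fun setT f.
  apply: measurable_and.
    by apply: measurable_fun_ler => //; apply: measurable_funD => //; exact: measurable_funX.
  apply: measurable_fun_ler.
    by apply: measurable_funM => //; apply: measurableT_comp => //; exact: measurable_snd.
  by apply: measurable_funM => //; apply: measurable_funB => //; exact: measurable_fst.
have [mrot _] := preserves_area_rot theta.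
have := measurableT_comp mf mrot measurableT (Y := [set true]).
by rewrite setTI; apply.
Qed.

Definition resistance_density (w : plane R -> R) (p : plane R) : \bar R :=
  (1 / (grad_norm2 w p + 1))%:E.

Lemma resistance_density_ge0 (w : plane R -> R) (p : plane R) :
  (0 <= resistance_density w p)%E.
Proof. by rewrite lee_fin divr_ge0// addr_ge0// addr_ge0// sqr_ge0. Qed.

Lemma resistance_density_le1 (w : plane R -> R) (p : plane R) :
  (resistance_density w p <= 1)%E.
Proof.
have g0 : 0 <= grad_norm2 w p by rewrite addr_ge0// sqr_ge0.
by rewrite lee_fin ler_pdivrMr ?mul1r ?lerDr// ltr_wpDl.
Qed.

(** Only the open sector, where the gradient is known, is counted. *)
Lemma profile_lower_bound :
  (\int[mu \x mu]_z profile_density z <=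
   \int[mu \x mu]_(p in (@Omega R : set (T * T)) `&` sector_region)
     resistance_density u p)%E.
Proof.
have p0 z : (0 <= profile_density z)%E.
  rewrite /profile_density; case: ifP => // _.
  by rewrite lee_fin invr_ge0 addr_ge0// sqr_ge0.
rewrite -rotated_integral//; last exact: measurable_cone.
rewrite [leRHS]integral_mkcond; apply: le_ge0_integral => p _; first exact: p0.
rewrite /profile_density; case: ifPn => [hp|_]; last first.
  by rewrite /patch; case: ifP => // _; exact: resistance_density_ge0.
have := hp; rewrite open_sectorE => /andP[h1 h2].
have hS : sector_region p by rewrite /sector_region/= closed_sectorE !ltW.
have hO : Omega (p : plane R) by rewrite (Omega_rot theta); exact: ltW.
rewrite /patch mem_set//= /resistance_density.
by rewrite (grad_profile rho0 rhoq qb b1 U_ge U_ray hp) div1r.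
Qed.

(** On the null set [edges], where nothing is known about the gradient, the
    integrand is still bounded by [1]. *)
Lemma competitor_upper_bound :
  (\int[mu \x mu]_(p in (@Omega R : set (T * T)) `&` sector_region)
     resistance_density v p <= \int[mu \x mu]_z competitor_density z)%E.
Proof.
pose g z := (competitor_density z + (if edges z then 1 else 0))%E.
have c0 z : (0 <= competitor_density z)%E.
  rewrite /competitor_density /sector_part; case: ifP => _; last by case: ifP.
  by rewrite lee_fin invr_ge0 addr_ge0// sqr_ge0.
have e0 z : (0 <= if edges z then 1 else 0 :> \bar R)%E by case: ifP.
have me : measurable_fun setT (fun z => if edges z then 1 else 0 : \bar R)%E.
  by apply: measurable_fun_ifT => //; exact: measurable_edges.
have mg : measurable_fun setT g.
  by apply: emeasurable_funD => //; exact: measurable_competitor_density.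
have g0 z : (0 <= g z)%E by rewrite adde_ge0.
have <- : (\int[mu \x mu]_z g z = \int[mu \x mu]_z competitor_density z)%E.
  rewrite ge0_integralD//; last exact: measurable_competitor_density.
  by rewrite edges_null adde0.
rewrite -rotated_integral// [leLHS]integral_mkcond.
apply: le_ge0_integral => p _.
  by rewrite /patch; case: ifP => // _; exact: resistance_density_ge0.
rewrite /patch; case: ifPn => // /set_mem[_].
rewrite /sector_region/= closed_sectorE /g => /andP[h1 h2].
case: ifPn => [_|]; first by rewrite (le_trans (resistance_density_le1 _ _))// leeDr.
rewrite adde0 /edges !negb_or => /and4P[e1 e2 e3 e4].
have hrho : open_sector rho b (rot theta p).
  have r1 : radius2 theta p != 1 by exact: e1.
  have m1 : margin b theta rho p != 0 by rewrite /margin subr_eq0 eq_sym.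
  by rewrite open_sectorE !lt_neqAle h1 h2 r1 eq_sym m1.
rewrite /competitor_density /sector_part hrho; case: ifPn => hq.
  by rewrite /resistance_density grad_competitor_cone// div1r.
have mq : margin b theta q p < 0.
  rewrite lt_neqAle /margin subr_eq0 eq_sym e3/= subr_le0 leNgt.
  by move: hq; rewrite /open_sector; move: hrho => /andP[-> _].
by rewrite /resistance_density grad_competitor_side// div1r.
Qed.

Lemma Omega_integral_fin (w : plane R -> R) (A : set (T * T)) :
  A `<=` (@Omega R : set (T * T)) ->
  (\int[mu \x mu]_(p in A) resistance_density w p)%E \is a fin_num.
Proof.
move=> AO; have I0 : (0 <= \int[mu \x mu]_(p in A) resistance_density w p)%E.
  by apply: integral_ge0 => p _; exact: resistance_density_ge0.
rewrite ge0_fin_numE//.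
pose B : set (T * T) := `[-1, 1]%classic `*` `[-1, 1]%classic.
have mB : measurable B by exact: measurableX.
apply: (@le_lt_trans _ _ (\int[mu \x mu]_(p in B) cst 1 p)%E).
  rewrite integral_mkcond [leRHS]integral_mkcond; apply: le_ge0_integral => p _.
    by rewrite /patch; case: ifP => // _; exact: resistance_density_ge0.
  rewrite /patch; case: ifPn => [/set_mem/AO hp|_]; last by case: ifP.
  rewrite mem_set; first exact: resistance_density_le1.
  have h1 := sqr_ge0 p.1; have h2 := sqr_ge0 p.2.
  by split; rewrite /= in_itv/= -ler_norml -(@expr_le1 _ 2)// real_normK ?num_real//;
    move: hp; rewrite /Omega/=; lra.
rewrite integral_cst// mul1e.
pose I : set T := `[-1, 1]%classic.
apply: (@le_lt_trans _ _ (mu I * mu I)%E).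
  by rewrite le_eqVlt; apply/orP; left; apply/eqP; exact: product_measure1E.
by rewrite /I !lebesgue_measure_itv/= lte_fin; case: ifP => _; rewrite ?mul0e// -EFinB -EFinM ltry.
Qed.

(** Off the sector both integrands coincide, and their common integral is
    finite. *)
Lemma J_competitor_lt : (J v < J u)%E.
Proof.
pose O : set (T * T) := @Omega R.
have mS := measurable_sector_region.
have split w : J w = (\int[mu \x mu]_(p in O `&` sector_region) resistance_density w p +
    \int[mu \x mu]_(p in O `\` sector_region) resistance_density w p)%E.
  by apply: (ge0_integral_split _ mS) => p _; exact: resistance_density_ge0.
rewrite !split.
have -> : (\int[mu \x mu]_(p in O `\` sector_region) resistance_density v p =
    \int[mu \x mu]_(p in O `\` sector_region) resistance_density u p)%E.
  apply: eq_integral => p /set_mem[_ hp].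
  by rewrite /resistance_density grad_outside//; exact/negP.
have fin := @Omega_integral_fin u (O `\` sector_region) (@subDsetl _ _ _).
rewrite lteD2rE//.
apply: le_lt_trans competitor_upper_bound _.
exact: lt_le_trans integral_density_lt profile_lower_bound.
Qed.

End comparison.

(** * The function is not a minimizer *)

(** The last three conditions are continuous in [beta] and hold strictly at
    [beta = 0]. *)
Lemma exists_opening (R : realType) (rho q sigma : R) :
  0 < rho -> rho < q -> q < 1 -> 0 < sigma ->
  exists beta, [/\ 0 < beta < pi, q < cos beta,
    Num.sqrt (1 - cos beta ^+ 2) <= cos beta * sigma &
    rho * (1 - q * cos beta) ^+ 3 < q * (1 - q) ^+ 3].
Proof.
move=> rho0 rhoq q1 sigma0.
have cc := @continuous_cos R 0; rewrite /continuous_at cos0 in cc.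
have cs := @continuous_sin R 0; rewrite /continuous_at sin0 in cs.
have n1 : \forall x \near (0 : R), q < cos x by exact: (cvgr_gt _ cc).
have n2 : \forall x \near (0 : R), sin x - cos x * sigma < 0.
  have : sin x - cos x * sigma @[x --> (0 : R)] --> 0 - 1 * sigma.
    by apply: cvgB => //; apply: cvgM => //; exact: cvg_cst.
  by move=> /cvgr_lt; apply; rewrite mul1r sub0r oppr_lt0.
have n3 : \forall x \near (0 : R), rho * (1 - q * cos x) ^+ 3 < q * (1 - q) ^+ 3.
  have : rho * (1 - q * cos x) ^+ 3 @[x --> (0 : R)] --> rho * (1 - q * 1) ^+ 3.
    apply: cvgM; first exact: cvg_cst.
    apply: (@cvg_comp _ _ _ _ (fun x : R => x ^+ 3)); last exact: exprn_continuous.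
    by apply: cvgB; [exact: cvg_cst|apply: cvgM => //; exact: cvg_cst].
  by move=> /cvgr_lt; apply; rewrite mulr1 ltr_pM2r// exprn_gt0// subr_gt0.
have [e e0 he] : exists2 e : R, 0 < e & forall x, `|x| < e ->
    [/\ q < cos x, sin x - cos x * sigma < 0 & rho * (1 - q * cos x) ^+ 3 < q * (1 - q) ^+ 3].
  have : \forall x \near (0 : R),
    [/\ q < cos x, sin x - cos x * sigma < 0 & rho * (1 - q * cos x) ^+ 3 < q * (1 - q) ^+ 3].
    by apply: filterS3 n1 n2 n3.
  move=> /nbhs_ballP[e /= e0 he]; exists e => // x xe; apply: he.
  by rewrite /ball/= sub0r normrN.
pose beta : R := Num.min (e / 2) 1.
have b0 : 0 < beta by rewrite lt_min ltr01 divr_gt0.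
have be : `|beta| < e.
  by rewrite gtr0_norm// gt_min; apply/orP; left; lra.
have bpi : beta < pi.
  have := pi_ge2 R; have : beta <= 1 by rewrite ge_min lexx orbT.
  lra.
have [h1 h2 h3] := he _ be.
exists beta; split => //; first by rewrite b0.
have s0 : 0 < sin beta by rewrite sin_gt0_pi// b0.
rewrite -(cos2Dsin2 beta) addrAC subrr add0r sqrtr_sqr gtr0_norm//.
by move: h2; lra.
Qed.

Theorem mainTheorem6 (R : realType) (M : R) (k : nat) (rho theta : R)
    (u : plane R -> R) :
  0 < M -> (2 <= k)%N -> 0 < rho -> rho < 1 ->
  (forall p : plane R, Omega p ->
     is_min [set z : R | body M (regular_polygon k rho theta) (p, z)] (u p)) ->
  ~ is_minimizer M u.
Proof.
move=> M0 k2 rho0 rho1 hu [Cu minu].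
(* Any abscissa strictly between rho and 1 would do for the new apex. *)
pose q := (1 + rho) / 2.
have rhoq : rho < q by rewrite /q; lra.
have q1 : q < 1 by rewrite /q; lra.
have sk : 0 < sin (pi / k%:R) :> R.
  have k0 : 0 < k%:R :> R by rewrite ltr0n (leq_trans _ k2).
  rewrite sin_gt0_pi// divr_gt0 ?pi_gt0//= ltr_pdivrMr// ltr_pMr ?pi_gt0//.
  by rewrite ltr1n.
have [beta [beta0 qb hb gain]] := exists_opening rho0 rhoq q1 sk.
have b0 : 0 < cos beta by apply: lt_trans qb; exact: lt_trans rhoq.
have b1 : cos beta < 1.
  have /andP[bt0 btpi] := beta0.
  by rewrite -(@cos0 R) ltr_cos// in_itv/= ?lexx ?pi_ge0//; rewrite !ltW.
have b01 : 0 < cos beta < 1 by rewrite b0.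
have U_ge := framed_ge M0 k2 rho0 rho1 hu b01 hb.
have U_ray := framed_ray k2 rho0 rho1 hu.
have Cv := C_competitor M0 rho0 rhoq qb b1 Cu U_ge U_ray.
have := minu _ Cv; apply/negP; rewrite -ltNge.
exact: (J_competitor_lt M0 rho0 rhoq qb beta0 gain U_ge U_ray).
Qed.
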